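(* Let $V$ be a Euclidean Jordan algebra of rank $r$ with unit $u$, equipped with the order-unit norm $\|\cdot\|_u$, and let $\overline{V}^h$ be the horofunction compactification of $(V,\|\cdot\|_u)$ with basepoint $0$. Let $p_1,\ldots,p_r$ be a Jordan frame, $I,J\subseteq\{1,\ldots,r\}$ with $I\cap J=\emptyset$ and $I\cup J$ nonempty, and $\alpha\in\mathbb{R}^{I\cup J}$ such that $\min\{\alpha_i\colon i\in I\cup J\}=0$. Then the function $h\colon V\to\mathbb{R}$ given by $$h(x)=\max\Big\{\Lambda_{V(p_I)}\Big(-U_{p_I}x-\sum_{i\in I}\alpha_ip_i\Big),\ \Lambda_{V(p_J)}\Big(U_{p_J}x-\sum_{j\in J}\alpha_jp_j\Big)\Big\}\quad\text{for }x\in V,\qquad(\ast)$$ is a horofunction, where, if $I$ or $J$ is empty, the corresponding term is omitted from the maximum. Moreover, each horofunction in $\overline{V}^h$ is of the form $(\ast)$ (for some such Jordan frame, $I$, $J$ and $\alpha$) and is a Busemann point.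
   Context: Euclidean Jordan algebra: a finite dimensional real Jordan algebra $(V,\bullet)$ with unit $u$ and an inner product for which every $L_x\colon y\mapsto x\bullet y$ is self-adjoint. Its cone is $V_+=\{x^2\colon x\in V\}$, inducing the order $x\le y\iff y-x\in V_+$, and $\|x\|_u=\inf\{\lambda\ge0\colon-\lambda u\le x\le\lambda u\}=\max\{|\lambda|\colon\lambda\in\sigma(x)\}$. A Jordan frame is a set $p_1,\dots,p_r$ of mutually orthogonal primitive idempotents with $p_1+\dots+p_r=u$, where $r$ is the rank. The quadratic representation is $U_xy=2x\bullet(x\bullet y)-x^2\bullet y$. For $I\subseteq\{1,\dots,r\}$ write $p_I=\sum_{i\in I}p_i$ (with $p_\emptyset=0$) and $V(p_I)=U_{p_I}(V)=\{x\in V\colon p_I\bullet x=x\}$, a subalgebra with unit $p_I$. For $z\in V(p_I)$, $\Lambda_{V(p_I)}(z)$ denotes the maximal eigenvalue of $z$ in the subalgebra $V(p_I)$. Horofunctions: with $h_y(z)=\|z-y\|_u-\|y\|_u$, $\overline{V}^h$ is the closure of $\{h_y\colon y\in V\}$ in $\mathbb{R}^V$ (pointwise convergence); the elements of $\partial\overline{V}^h=\overline{V}^h\setminus\{h_y\colon y\in V\}$ are the horofunctions. A net $(x^\alpha)$ in $V$ is almost geodesic if there is $w\in V$ such that for all $\epsilon>0$ there is $\beta$ with $\|x^\alpha-x^{\alpha'}\|_u+\|x^{\alpha'}-w\|_u-\|x^\alpha-w\|_u<\epsilon$ for all $\alpha\ge\alpha'\ge\beta$. A horofunction is a Busemann point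 if it is the limit of $h_{x^\alpha}$ for some almost geodesic net $(x^\alpha)$. *)

(* Defs.v *)
From HB Require Import structures.
From mathcomp Require Import all_boot all_order all_algebra.
From mathcomp Require Import all_classical all_reals all_analysis.

Set Implicit Arguments.
Unset Strict Implicit.
Unset Printing Implicit Defensive.

Import Order.TTheory GRing.Theory Num.Theory.
Import numFieldNormedType.Exports.

Local Open Scope classical_set_scope.
Local Open Scope ring_scope.

Record euclidean_jordan_algebra (R : realType) (V : vectType R) := EJA {
  jmul : V -> V -> V;
  junit : V;
  jip : V -> V -> R;
  jmul_linear : forall x, linear (jmul x);
  jmulC : forall x y, jmul x y = jmul y x;
  jmul_jordan : forall x y,
    jmul x (jmul (jmul x x) y) = jmul (jmul x x) (jmul x y);
  jmul1 : forall x, jmul junit x = x;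
  jip_linear : forall x, scalar (jip x);
  jipC : forall x y, jip x y = jip y x;
  jip_gt0 : forall x, x != 0 -> 0 < jip x x;
  jip_selfadjoint : forall x y z, jip (jmul x y) z = jip y (jmul x z) }.

Section JordanAlgebra.
Context (R : realType) (V : vectType R) (A : euclidean_jordan_algebra V).
Implicit Types (x y z p : V) (l : R).

Local Notation "x • y" := (jmul A x y) (at level 40, left associativity).
Local Notation u := (junit A).

Definition jpowers x (k : nat) : seq V :=
  [seq iter i (jmul A x) u | i <- iota 0 k].

(* The degree of the minimal polynomial of x: the least k > 0 such that
   u, x, ..., x^k are linearly dependent. *)
Definition jdegree x (k : nat) : Prop :=
  [/\ (0 < k)%N, ~~ free (jpowers x k.+1) &
      forall j : nat, (0 < j < k)%N -> free (jpowers x j.+1)].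

Definition jrank (r : nat) : Prop :=
  (exists x, jdegree x r) /\ (forall x k, jdegree x k -> (k <= r)%N).

Definition jcone : set V := [set x • x | x in [set: V]].

Definition jle x y : Prop := jcone (y - x).

Definition unorm x : R :=
  inf [set l | 0 <= l /\ jle (- (l *: u)) x /\ jle x (l *: u)].

Definition jidempotent (c : V) : Prop := c • c = c.

Definition jprimitive (c : V) : Prop :=
  [/\ jidempotent c, c != 0 &
      ~ exists d e, [/\ jidempotent d, jidempotent e, d != 0, e != 0 &
                        c = d + e]].

Definition jordan_frame (r : nat) (p : 'I_r -> V) : Prop :=
  [/\ forall i, jprimitive (p i),
      forall i j, i != j -> p i • p j = 0 &
      \sum_i p i = u].

Definition quadrep x y : V := 2 *: (x • (x • y)) - (x • x) • y.

Definition peirce p : set V := range (quadrep p).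

(* For an idempotent p, [jeigenvalue p z l] says that l is an eigenvalue of z
   in the subalgebra V(p), whose unit is p: one of the coefficients in the
   spectral decomposition z = \sum_i mu_i c_i, where the mu_i are distinct and
   the c_i form a complete system of nonzero orthogonal idempotents of V(p). *)
Definition jeigenvalue p z l : Prop :=
  exists (k : nat) (c : 'I_k -> V) (mu : 'I_k -> R),
    [/\ injective mu,
        forall i, [/\ peirce p (c i), jidempotent (c i) & c i != 0],
        forall i j, i != j -> c i • c j = 0,
        \sum_i c i = p &
        z = \sum_i mu i *: c i /\ exists i, mu i = l].

(* By the spectral theorem the set is finite, and nonempty if p != 0 and
   z is in V(p); the supremum is then a maximum. *)
Definition max_eigenvalue p z : R := sup [set l | jeigenvalue p z l].

Definition frame_sum (r : nat) (p : 'I_r -> V) (I : {set 'I_r}) : V :=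
  \sum_(i in I) p i.

Definition frame_horo (r : nat) (p : 'I_r -> V) (I J : {set 'I_r})
    (alpha : 'I_r -> R) (x : V) : R :=
  let pI := frame_sum p I in
  let pJ := frame_sum p J in
  let LI := max_eigenvalue pI
              (- quadrep pI x - \sum_(i in I) alpha i *: p i) in
  let LJ := max_eigenvalue pJ
              (quadrep pJ x - \sum_(j in J) alpha j *: p j) in
  if I == finset.set0 then LJ
  else if J == finset.set0 then LI
  else Num.max LI LJ.

(* Only the values of alpha on I :|: J matter; the last two conditions say
   that their minimum is 0. *)
Definition horo_data (r : nat) (I J : {set 'I_r}) (alpha : 'I_r -> R) : Prop :=
  [/\ I :&: J = finset.set0,
      I :|: J != finset.set0,
      forall i, i \in I :|: J -> 0 <= alpha i &
      exists2 i, i \in I :|: J & alpha i = 0].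

Definition hfun y : {ptws V -> R} := fun z => unorm (z - y) - unorm y.

Definition horo_compactification : set {ptws V -> R} := closure (range hfun).

Definition horofunction : set {ptws V -> R} :=
  horo_compactification `\` range hfun.

Definition directed_preorder (D : Type) (le : D -> D -> Prop) : Prop :=
  [/\ inhabited D, forall a, le a a,
      forall a b c, le a b -> le b c -> le a c &
      forall a b, exists c, le a c /\ le b c].

Definition net_tails (D : Type) (le : D -> D -> Prop) : set_system D :=
  [set S | exists b, forall a, le b a -> S a].

Definition almost_geodesic (D : Type) (le : D -> D -> Prop) (x : D -> V) :=
  exists w, forall eps : R, 0 < eps -> exists b, forall a a',
    le b a' -> le a' a ->
    unorm (x a - x a') + unorm (x a' - w) - unorm (x a - w) < eps.

Definition busemann_point (g : {ptws V -> R}) : Prop :=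
  horofunction g /\
  exists (D : Type) (le : D -> D -> Prop) (x : D -> V),
    [/\ directed_preorder le, almost_geodesic le x &
        {ptws, (fun a => hfun (x a)) @ net_tails le --> g}].

End JordanAlgebra.

(* Main.v *)
From HB Require Import structures.
Require Import Defs.
From mathcomp Require Import all_boot all_order all_algebra.
From mathcomp Require Import all_classical all_reals all_analysis.
From mathcomp Require Import ring lra.

Set Implicit Arguments.
Unset Strict Implicit.
Unset Printing Implicit Defensive.

Import Order.TTheory GRing.Theory Num.Theory.
Import numFieldNormedType.Exports.

Local Open Scope classical_set_scope.
Local Open Scope ring_scope.

(** Everything is read off the quadratic forms [qform x s = ⟪x, s • s⟫] on
    vectors [s] with [⟪s, s⟫ = 1].  By the spectral theorem, [x] lies in the
    cone iff its form is nonnegative ([jconeP]), [unorm x] is the maximum of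
    [`|qform x s|] ([unorm_bound], [unorm_attained]), and the maximal eigenvalue
    of [z] in the subalgebra of an idempotent [p] is the maximum of [qform z s]
    over the [s] with [p • s = s] ([max_eigenvalueP]).

    Let [y = \sum_i mu i *: q i] for a frame [q] and put [n = unorm y].  Since the
    forms of the [q i] add up to 1 on unit vectors, [hfun y x] is the maximum
    over [s] of [qform x s - \sum_i (n + mu i) * qform (q i) s] and of
    [qform (- x) s - \sum_i (n - mu i) * qform (q i) s].  All the weights
    [n + mu i] and [n - mu i] are nonnegative, and one of them is 0.  Let [y] go
    to infinity along an ultrafilter.  The frames converge, because the unit
    ball is compact and a limit of nonzero idempotents is not 0, and each weight
    converges or tends to infinity.  With [J] the set of indices for which
    [n + mu i] has a finite limit [alpha i], and [I] that for which [n - mu i]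
    has one, an infinite weight forces [qform (p i) s = 0], that is
    [p i • s = 0], so that only vectors [s] of the subalgebra of [\sum_(i in J) p i]
    (resp. of [I]) survive, and the limit is [frame_horo p I J alpha]
    ([frame_horo_limit]).  The sets [I] and [J] are disjoint because the sum of
    the two weights of [i] is [2 * n].

    Conversely [frame_horo p I J alpha] is the limit along an explicit ray in the
    span of [p] that is geodesic, so that it is a Busemann point; it is no [hfun y]
    because it is not bounded below.

    The limits of frames with [r] elements also give, for every element, a frame
    of exactly [r] elements that diagonalizes it ([frame_decomposition]): this is
    clear for the elements of degree [r], and they are dense.

    The spectral theorem itself follows from the existence of an eigenvector of
    a self-adjoint operator on a subspace ([self_adjoint_eigenvector]), which is
    a maximum of the Rayleigh quotient, and from power associativity
    ([jpowD]). *)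

(** * Jordan algebra identities *)

Section Jordan.
Context (R : realType) (V : vectType R) (A : euclidean_jordan_algebra V).
Implicit Types (x y z p c s : V) (l : R).

Local Notation "x • y" := (jmul A x y) (at level 40, left associativity).
Local Notation "⟪ x , y ⟫" := (jip A x y) (format "⟪ x ,  y ⟫").
Local Notation u := (junit A).

Lemma jmulDr x y z : x • (y + z) = x • y + x • z.
Proof. by have := jmul_linear A x 1 y z; rewrite !scale1r. Qed.

Lemma jmulr0 x : x • 0 = 0.
Proof. by apply: (addrI (x • 0)); rewrite -jmulDr !addr0. Qed.

Lemma jmulZr l x y : x • (l *: y) = l *: (x • y).
Proof. by have := jmul_linear A x l y 0; rewrite jmulr0 !addr0. Qed.

Lemma jmulDl x y z : (y + z) • x = y • x + z • x.
Proof. by rewrite !(jmulC A _ x) jmulDr. Qed.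

Lemma jmulZl l x y : (l *: y) • x = l *: (y • x).
Proof. by rewrite !(jmulC A _ x) jmulZr. Qed.

Lemma jmulNr x y : x • (- y) = - (x • y).
Proof. by rewrite -scaleN1r jmulZr scaleN1r. Qed.

Lemma jmulNl x y : (- y) • x = - (y • x).
Proof. by rewrite !(jmulC A _ x) jmulNr. Qed.

Lemma jmul0l x : 0 • x = 0.
Proof. by rewrite jmulC jmulr0. Qed.

Lemma jmulr1 x : x • u = x.
Proof. by rewrite jmulC jmul1. Qed.

Lemma jmul_sumr (T : Type) (r : seq T) (P : pred T) x (f : T -> V) :
  x • (\sum_(i <- r | P i) f i) = \sum_(i <- r | P i) x • f i.
Proof. by apply: (big_morph _ (jmulDr x)); rewrite jmulr0. Qed.

Lemma jmul_suml (T : Type) (r : seq T) (P : pred T) x (f : T -> V) :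
  (\sum_(i <- r | P i) f i) • x = \sum_(i <- r | P i) f i • x.
Proof. by rewrite jmulC jmul_sumr; under eq_bigr do rewrite jmulC. Qed.

Lemma jipDr x y z : ⟪x, y + z⟫ = ⟪x, y⟫ + ⟪x, z⟫.
Proof. by have := jip_linear A x 1 y z; rewrite scale1r mul1r. Qed.

Lemma jipr0 x : ⟪x, 0⟫ = 0.
Proof. by apply: (addrI ⟪x, 0⟫); rewrite -jipDr !addr0. Qed.

Lemma jipZr l x y : ⟪x, l *: y⟫ = l * ⟪x, y⟫.
Proof. by have := jip_linear A x l y 0; rewrite jipr0 !addr0. Qed.

Lemma jipNr x y : ⟪x, - y⟫ = - ⟪x, y⟫.
Proof. by rewrite -scaleN1r jipZr mulN1r. Qed.

Lemma jipDl x y z : ⟪y + z, x⟫ = ⟪y, x⟫ + ⟪z, x⟫.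
Proof. by rewrite !(jipC A _ x) jipDr. Qed.

Lemma jipZl l x y : ⟪l *: y, x⟫ = l * ⟪y, x⟫.
Proof. by rewrite !(jipC A _ x) jipZr. Qed.

Lemma jipNl x y : ⟪- y, x⟫ = - ⟪y, x⟫.
Proof. by rewrite !(jipC A _ x) jipNr. Qed.

Lemma jip0l x : ⟪0, x⟫ = 0.
Proof. by rewrite jipC jipr0. Qed.

Lemma jip_sumr (T : Type) (r : seq T) (P : pred T) x (f : T -> V) :
  ⟪x, \sum_(i <- r | P i) f i⟫ = \sum_(i <- r | P i) ⟪x, f i⟫.
Proof. by apply: (big_morph _ (jipDr x)); rewrite jipr0. Qed.

Lemma jip_suml (T : Type) (r : seq T) (P : pred T) x (f : T -> V) :
  ⟪\sum_(i <- r | P i) f i, x⟫ = \sum_(i <- r | P i) ⟪f i, x⟫.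
Proof. by rewrite jipC jip_sumr; under eq_bigr do rewrite jipC. Qed.

Lemma jip_ge0 x : 0 <= ⟪x, x⟫.
Proof. by have [->|/jip_gt0 /ltW//] := eqVneq x 0; rewrite jipr0. Qed.

Lemma jip_eq0 x : (⟪x, x⟫ == 0) = (x == 0).
Proof.
have [->|x0] := eqVneq x 0; first by rewrite jipr0 eqxx.
by rewrite gt_eqF // jip_gt0.
Qed.

(** Equations between vectors become scalar equations, on which linear
    arithmetic can be used. *)
Lemma jip_inj x y : (forall z, ⟪x, z⟫ = ⟪y, z⟫) -> x = y.
Proof.
move=> xy; apply/eqP; rewrite -subr_eq0 -jip_eq0 jipDl jipNl xy; apply/eqP.
exact: subrr.
Qed.

Definition jmulE := (jmulDl, jmulDr, jmulNl, jmulNr, jmulZl, jmulZr).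
Definition jipE := (jipDl, jipNl, jipZl).

(** The Jordan identity is cubic in its first variable.  Its part of degree 1 in
    [a] and 2 in [b] is isolated with the values at [a], [a + b] and [a - b]; the
    trilinear identity follows in the same way. *)
Lemma jordan_polarized2 a b y :
  a • ((b • b) • y) + 2 *: (b • ((a • b) • y)) =
  (b • b) • (a • y) + 2 *: ((a • b) • (b • y)).
Proof.
apply: jip_inj => z.
have := congr1 (fun v => ⟪v, z⟫) (jmul_jordan A (a + b) y).
have := congr1 (fun v => ⟪v, z⟫) (jmul_jordan A (a - b) y).
have := congr1 (fun v => ⟪v, z⟫) (jmul_jordan A a y).
by rewrite !jmulE (jmulC A b a) ?jmulE !jipE; lra.
Qed.

Lemma jordan_polarized x y z w :
  x • ((y • z) • w) + y • ((z • x) • w) + z • ((x • y) • w) =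
  (y • z) • (x • w) + (z • x) • (y • w) + (x • y) • (z • w).
Proof.
apply: jip_inj => v.
have := congr1 (fun t => ⟪t, v⟫) (jordan_polarized2 x (y + z) w).
have := congr1 (fun t => ⟪t, v⟫) (jordan_polarized2 x y w).
have := congr1 (fun t => ⟪t, v⟫) (jordan_polarized2 x z w).
rewrite !jmulE (jmulC A z y) (jmulC A z x) ?jmulE !jipE; lra.
Qed.

(** The polarized identity, read as a formula for the multiplication operator
    of a product of three elements. *)
Lemma jmul3E x z w y :
  ((z • x) • w) • y = (z • w) • (x • y) + (x • w) • (z • y) + (z • x) • (w • y)
    - z • (w • (x • y)) - x • (w • (z • y)).
Proof.
have := jordan_polarized x y z w.
rewrite (jmulC A y z) (jmulC A (z • y) w) (jmulC A (x • y) w).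
rewrite (jmulC A (z • y) (x • w)) (jmulC A (x • y) (z • w)) (jmulC A y (_ • w)).
rewrite (jmulC A y w) => H; apply: jip_inj => v.
by move: (congr1 (fun t => ⟪t, v⟫) H); rewrite !jipE; lra.
Qed.

(** * Powers of an element *)

Definition jpow x n := iter n (jmul A x) u.

Lemma jpow1 x : jpow x 1 = x.
Proof. exact: jmulr1. Qed.

(** [jmul3E] makes the multiplication by a power of [x] a polynomial in those by
    [x] and [x • x], which commute by the Jordan identity. *)
Lemma jpow_comm x n y :
  x • (jpow x n • y) = jpow x n • (x • y) /\
  (x • x) • (jpow x n • y) = jpow x n • ((x • x) • y).
Proof.
have [m] := ubnP n; elim: m n y => // m IH [|[|n]] y lt_nm.
- by rewrite !jmul1.
- by rewrite jpow1; split => //; rewrite jmul_jordan.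
have E z : jpow x n.+2 • z = 2 *: (jpow x n.+1 • (x • z))
   + (x • x) • (jpow x n • z) - jpow x n • (x • (x • z))
   - x • (x • (jpow x n • z)).
  have -> : jpow x n.+2 = (jpow x n • x) • x.
    by rewrite (jmulC A (jpow x n)) jmulC.
  rewrite jmul3E (jmulC A (jpow x n) x) -[x • jpow x n]/(jpow x n.+1).
  by apply: jip_inj => v; rewrite !jipE; lra.
have IH1 k z : (k < m)%N -> x • (jpow x k • z) = jpow x k • (x • z).
  by move=> /(IH k z)[].
have IH2 k z : (k < m)%N ->
    (x • x) • (jpow x k • z) = jpow x k • ((x • x) • z).
  by move=> /(IH k z)[].
have Jx z : x • ((x • x) • z) = (x • x) • (x • z) by rewrite jmul_jordan.
have ltn : (n < m)%N by exact: ltnW lt_nm.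
rewrite !E !jmulE; split.
  by rewrite !IH1 ?Jx ?IH1.
by rewrite -!Jx !IH2 // -?Jx ?IH2.
Qed.

Lemma jpowD x m n : jpow x m • jpow x n = jpow x (m + n).
Proof.
elim: m => [|m IH]; first by rewrite jmul1.
rewrite jmulC [jpow x m.+1]iterS -/(jpow x m) -(jpow_comm x n _).1.
by rewrite (jmulC A (jpow x n)) IH.
Qed.

(** * Idempotents *)

Lemma idem_cubic c y : jidempotent A c ->
  c • y = 3 *: (c • (c • y)) - 2 *: (c • (c • (c • y))).
Proof.
move=> cc; have := jmul3E c c c y; rewrite !cc => {1}->.
by apply: jip_inj => v; rewrite !jipE; lra.
Qed.

(** The eigenvalues 0, 1/2, 1 of the multiplication by an idempotent satisfy
    [t = t ^ 2 + 4 * (t - t ^ 2) ^ 2], whence a sum of squares. *)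
Lemma idem_form c s : jidempotent A c ->
  ⟪c • s, s⟫ = ⟪c • s, c • s⟫ +
    4 * ⟪c • s - c • (c • s), c • s - c • (c • s)⟫.
Proof.
move=> cc; set y := c • s; set z := c • y.
have adj v w : ⟪c • v, w⟫ = ⟪v, c • w⟫ by rewrite jip_selfadjoint.
have E1 : ⟪y, y⟫ = ⟪z, s⟫ by rewrite [RHS]adj.
have E2 : ⟪z, y⟫ = ⟪c • z, s⟫ by rewrite [RHS]adj.
have E3 : ⟪z, z⟫ = ⟪c • (c • z), s⟫ by rewrite [RHS]adj [RHS]adj.
have := congr1 (fun v => ⟪v, s⟫) (idem_cubic s cc).
have := congr1 (fun v => ⟪v, s⟫) (idem_cubic y cc).
rewrite -/y -/z !jipE !(jipDr, jipNr) (jipC A y z) E1 E2 E3; lra.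
Qed.

Lemma idem_form_ge c s : jidempotent A c -> ⟪c • s, c • s⟫ <= ⟪c • s, s⟫.
Proof. by move=> cc; rewrite idem_form // lerDl mulr_ge0 ?jip_ge0. Qed.

Lemma idem_form_ge0 c s : jidempotent A c -> 0 <= ⟪c • s, s⟫.
Proof. by move=> cc; rewrite (le_trans _ (idem_form_ge _ cc)) ?jip_ge0. Qed.

Lemma idem_form_eq0 c s : jidempotent A c -> ⟪c • s, s⟫ = 0 -> c • s = 0.
Proof.
move=> cc cs0; apply/eqP; rewrite -jip_eq0 eq_le jip_ge0 andbT -cs0.
exact: idem_form_ge.
Qed.

(** The extreme Peirce spaces of [c] commute with [c] as operators. *)
Lemma peirce_comm c a i y : jidempotent A c -> (i == 0) || (i == 1) ->
  c • a = i *: a -> c • (a • y) = a • (c • y).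
Proof.
move=> cc i01 ca; have := jordan_polarized c c a y.
rewrite cc (jmulC A a c) ca !jmulE => H.
apply: jip_inj => v; move: (congr1 (fun t => ⟪t, v⟫) H); rewrite !jipE.
by case/orP: i01 => /eqP->; lra.
Qed.

End Jordan.

(** * Limits along ultrafilters *)

Lemma ultra_bounded_cvg (R : realType) (T : Type) (F : set_system T)
    (FU : UltraFilter F) (f : T -> R) (C : R) :
  F [set t | `|f t| <= C] -> exists l : R, f @ F --> l.
Proof.
move=> fC; have fFC : (f @ F) [set` `[- C, C]].
  by apply: (@filterS _ F) fC => t /=; rewrite in_itv /= ler_norml.
have [l [_ cl]] := @segment_compact R (- C) C (f @ F) _ fFC.
exists l => B /cl clB.
have [//|FnB] := in_ultra_setVsetC (f @^-1` B) FU.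
by have [t []] := clB (~` B) FnB.
Qed.

Section WeakConvergence.
Context (R : realType) (V : vectType R) (A : euclidean_jordan_algebra V).
Implicit Types (x y z v w : V).

Local Notation "x • y" := (jmul A x y) (at level 40, left associativity).
Local Notation "⟪ x , y ⟫" := (jip A x y) (format "⟪ x ,  y ⟫").
Local Notation u := (junit A).

HB.instance Definition _ x := GRing.isLinear.Build R V V _ (jmul A x)
  (jmul_linear A x).
HB.instance Definition _ x := GRing.isLinear.Build R V R^o _ (jip A x)
  (jip_linear A x).

Let n := \dim {:V}.
Let b : n.-tuple V := vbasis {:V}.

Definition gram_row x : 'rV[R]_n := \row_i ⟪x, b`_i⟫.

Lemma gram_row_is_linear : linear gram_row.
Proof. by move=> l x y; apply/rowP => i; rewrite !mxE jipDl jipZl. Qed.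

HB.instance Definition _ := GRing.isLinear.Build R V _ _ gram_row
  gram_row_is_linear.

Lemma coord_basisE v : v = \sum_(i < n) coord b i v *: b`_i.
Proof. exact: coord_vbasis (memvf v). Qed.

Lemma riesz (phi : V -> R) : scalar phi ->
  exists z, forall v, phi v = ⟪v, z⟫.
Proof.
move=> phi_lin; have phi0 : phi 0 = 0.
  by have := phi_lin (-1) 0 0; rewrite scaler0 addr0 mulN1r addNr.
have phi_sum (a : 'I_n -> R) :
    phi (\sum_i a i *: b`_i) = \sum_i a i * phi b`_i.
  have phiD : {morph phi : x y / x + y}.
    by move=> x y; have := phi_lin 1 x y; rewrite scale1r mul1r.
  rewrite (big_morph phi phiD phi0); apply: eq_bigr => i _.
  by have := phi_lin (a i) b`_i 0; rewrite phi0 !addr0.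
have inj : lker (linfun gram_row) == 0%VS.
  apply/lker0P => v w; rewrite !lfunE => /rowP vw.
  apply/(@jip_inj _ _ A) => z; rewrite [z]coord_basisE !jip_sumr.
  by apply: eq_bigr => i _; rewrite !jipZr; have := vw i; rewrite !mxE => ->.
have img : limg (linfun gram_row) = fullv.
  apply/eqP; rewrite eqEdim subvf limg_dim_eq ?(eqP inj) ?capv0 //.
  by rewrite dimvf /dim /= mul1n.
have /memv_imgP [z _ zE] : (\row_i phi b`_i) \in limg (linfun gram_row).
  by rewrite img memvf.
exists z => v; rewrite {1}[v]coord_basisE phi_sum [v in RHS]coord_basisE.
rewrite jip_suml; apply: eq_bigr => i _; rewrite jipZl jipC; congr (_ * _).
by have /rowP/(_ i) := zE; rewrite lfunE !mxE.
Qed.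

(** In finite dimension weak limits are limits, and tests against the inner
    product need no topology on the space. *)
Definition wcvg (T : Type) (F : set_system T) (f : T -> V) v :=
  forall z, ⟪f t, z⟫ @[t --> F] --> ⟪v, z⟫.

Section Filter.
Context (T : Type) (F : set_system T) {FF : ProperFilter F}.
Implicit Types (f g : T -> V) (a : T -> R).

Lemma wcvg_unique f v w : wcvg F f v -> wcvg F f w -> v = w.
Proof.
by move=> fv fw; apply: jip_inj => z; apply: cvg_unique (fv z) (fw z).
Qed.

Lemma wcvg_cst v : wcvg F (fun=> v) v.
Proof. by move=> z; apply: cvg_cst. Qed.

Lemma wcvgD f g v w : wcvg F f v -> wcvg F g w ->
  wcvg F (fun t => f t + g t) (v + w).
Proof.
by move=> fv gw z; under eq_cvg do rewrite jipDl; rewrite jipDl; apply: cvgD.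
Qed.

Lemma wcvgZ a f (l : R) v : a @ F --> l -> wcvg F f v ->
  wcvg F (fun t => a t *: f t) (l *: v).
Proof.
by move=> al fv z; under eq_cvg do rewrite jipZl; rewrite jipZl; apply: cvgM.
Qed.

Lemma wcvgB f g v w : wcvg F f v -> wcvg F g w ->
  wcvg F (fun t => f t - g t) (v - w).
Proof.
move=> fv gw; rewrite -[- w]scaleN1r.
under [fun t => _]eq_fun do rewrite -[- g _]scaleN1r.
by apply: wcvgD => //; apply: wcvgZ => //; apply: cvg_cst.
Qed.

Lemma wcvg_sum (I : Type) (r : seq I) (P : pred I) (f : T -> I -> V)
    (v : I -> V) :
  (forall i, P i -> wcvg F (f^~ i) (v i)) ->
  wcvg F (fun t => \sum_(i <- r | P i) f t i) (\sum_(i <- r | P i) v i).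
Proof.
move=> fv z; under eq_cvg do rewrite jip_suml; rewrite jip_suml.
by apply: cvg_big => [|i Pi]; [apply: add_continuous|apply: fv].
Qed.

Lemma wcvg_scalar f v (phi : V -> R) : scalar phi -> wcvg F f v ->
  phi (f t) @[t --> F] --> phi v.
Proof.
move=> /riesz[z phiE] fv; rewrite phiE; under eq_cvg do rewrite phiE.
exact: fv.
Qed.

Lemma wcvg_linear f v (phi : {linear V -> V}) : wcvg F f v ->
  wcvg F (phi \o f) (phi v).
Proof.
move=> fv z; apply: (wcvg_scalar (phi := fun x => ⟪phi x, z⟫)) => //.
by move=> l x y; rewrite linearP jipDl jipZl.
Qed.

Lemma wcvg_coord f v i : wcvg F f v ->
  coord b i (f t) @[t --> F] --> coord b i v.
Proof. by move=> fv; apply: (wcvg_scalar _ fv) => l x y; rewrite linearP. Qed.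

Lemma wcvg_jmul f g v w : wcvg F f v -> wcvg F g w ->
  wcvg F (fun t => f t • g t) (v • w).
Proof.
move=> fv gw; rewrite [v]coord_basisE jmul_suml.
have -> : (fun t => f t • g t) =
    (fun t => \sum_(i < n) coord b i (f t) *: (b`_i • g t)).
  apply/funext => t; rewrite {1}[f t]coord_basisE jmul_suml.
  by apply: eq_bigr => i _; rewrite jmulZl.
apply: wcvg_sum => i _; rewrite jmulZl.
by apply: wcvgZ; [apply: wcvg_coord|exact: (@wcvg_linear g w (jmul A b`_i) gw)].
Qed.

Lemma wcvg_jip f g v w : wcvg F f v -> wcvg F g w ->
  ⟪f t, g t⟫ @[t --> F] --> ⟪v, w⟫.
Proof.
have E x y : ⟪x, y⟫ = ⟪x • y, u⟫ by rewrite jip_selfadjoint jmulr1 jipC.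
move=> fv gw; under eq_cvg do rewrite E; rewrite E.
exact: (wcvg_jmul fv gw).
Qed.

End Filter.

Lemma jip_bound x y : `|⟪x, y⟫| <= ⟪x, x⟫ + ⟪y, y⟫.
Proof.
have := jip_ge0 A (x + y); have := jip_ge0 A (x - y).
have := jip_ge0 A x; have := jip_ge0 A y.
rewrite !(jipDl, jipDr, jipNl, jipNr) (jipC A y x) ler_norml.
by move=> *; apply/andP; split; lra.
Qed.

(** Bounded families converge along ultrafilters: the limits of the scalar
    products with the [f t] are linear, hence represented by a vector. *)
Lemma ultra_bounded_wcvg (T : Type) (F : set_system T) (FU : UltraFilter F)
    (f : T -> V) (C : R) :
  F [set t | ⟪f t, f t⟫ <= C] -> exists v, wcvg F f v.
Proof.
move=> fC; have /choice[phi phiP] z : exists l : R, ⟪f t, z⟫ @[t --> F] --> l.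
  apply: (ultra_bounded_cvg FU (C := C + ⟪z, z⟫)).
  by apply: filterS fC => t /= tC; rewrite (le_trans (jip_bound _ _))// lerD2r.
have [|v phiE] := @riesz phi.
  move=> l x y; have fxy : ⟪f t, l *: x + y⟫ @[t --> F] --> l * phi x + phi y.
    under eq_cvg do rewrite jipDr jipZr.
    by apply: cvgD => //; apply: cvgM => //; apply: cvg_cst.
  exact: cvg_unique (phiP _) fxy.
by exists v => z; rewrite jipC -phiE; apply: phiP.
Qed.

End WeakConvergence.

(** * Spectral theorem *)

Lemma sum_option (U : nmodType) (T : finType) (F : option T -> U) :
  \sum_o F o = F None + \sum_i F (Some i).
Proof.
rewrite (bigD1 None) //=; congr (_ + _).
rewrite (reindex_omap Some id) /=; last by case.
by apply: eq_bigl => i; rewrite eqxx.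
Qed.

Section Spectral.
Context (R : realType) (V : vectType R) (A : euclidean_jordan_algebra V).
Implicit Types (x y z v w c : V) (W S : {vspace V}) (l : R).

Local Notation "x • y" := (jmul A x y) (at level 40, left associativity).
Local Notation "⟪ x , y ⟫" := (jip A x y) (format "⟪ x ,  y ⟫").
Local Notation u := (junit A).

Lemma cvg_le (T : Type) (F : set_system T) {FF : ProperFilter F} (f g : T -> R)
    (a b : R) :
  f @ F --> a -> g @ F --> b -> F [set t | f t <= g t] -> a <= b.
Proof.
move=> fa gb fg; rewrite -subr_ge0; apply: (cvgr_to_ge (cvgB gb fa)).
by apply: filterS fg => t /=; rewrite subr_ge0.
Qed.

Lemma wcvg_memv (T : Type) (F : set_system T) {FF : ProperFilter F}
    (f : T -> V) v W : wcvg A F f v -> F [set t | f t \in W] -> v \in W.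
Proof.
move=> fv fW; have <- : projv W v = v; last exact: memv_proj.
have pfv := @wcvg_linear _ _ _ _ _ _ _ (projv W) fv.
apply: (wcvg_unique pfv) => z; apply: cvg_trans (fv z).
apply: near_eq_cvg; apply: filterS fW => t /= ftW.
by rewrite projv_id.
Qed.

Lemma jip_normalize v : v != 0 ->
  let s := (Num.sqrt ⟪v, v⟫)^-1 *: v in ⟪s, s⟫ = 1.
Proof.
move=> v0 /=; rewrite jipZl jipZr mulrA -invfM -expr2 sqr_sqrtr ?jip_ge0 //.
by rewrite mulVf // jip_eq0.
Qed.

(** The sets of unit vectors on which the Rayleigh quotient is at least one of its
    values generate a filter, and at the limit of an ultrafilter above it the
    quotient is maximal. *)
Lemma rayleigh_max x W : W != 0%VS ->
  exists s, [/\ s \in W, ⟪s, s⟫ = 1 &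
    forall w, w \in W -> ⟪w, w⟫ = 1 -> ⟪x • w, w⟫ <= ⟪x • s, s⟫].
Proof.
move=> W0; pose S := [set s | s \in W /\ ⟪s, s⟫ = 1].
pose f w := ⟪x • w, w⟫.
pose F := filter_from S (fun s => S `&` [set w | f s <= f w]).
have FF : ProperFilter F.
  apply: filter_from_proper => [|s Ss]; last by exists s; split => /=.
  apply: filter_from_filter.
    pose v := vpick W; have v0 : v != 0 by rewrite vpick0.
    exists ((Num.sqrt ⟪v, v⟫)^-1 *: v); split; last exact: jip_normalize.
    by rewrite memvZ // memv_pick.
  move=> s t Ss St; have [fst|fts] := leP (f s) (f t).
    exists t => // w /= [Sw ftw]; split; split => //=.
    exact: le_trans ftw.
  exists s => // w /= [Sw fsw]; split; split => //=.
  exact: le_trans (ltW fts) fsw.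
have [G [GU FG]] := ultraFilterLemma FF.
have GP := @ultra_proper _ _ GU.
have GS : G S.
  have [s Ss _] : F setT := filterT.
  by apply: FG; exists s => // w [].
have GW : G [set w | w \in W] by apply: filterS GS => w [].
have G1 : G [set w | ⟪w, w⟫ <= 1] by apply: filterS GS => w /= [_ ->].
have [s Gs] := ultra_bounded_wcvg GU G1.
have ss : ⟪s, s⟫ = 1.
  have cs : ⟪t, t⟫ @[t --> G] --> ⟪s, s⟫ by apply: wcvg_jip.
  have c1 : (fun=> 1 : R) @ G --> (1 : R) by apply: cvg_cst.
  apply/eqP; rewrite eq_le; apply/andP; split.
    exact: (cvg_le cs c1 G1).
  by apply: (cvg_le c1 cs); apply: filterS GS => w /= [_ ->].
exists s; split=> //; first exact: wcvg_memv GW.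
move=> w wW w1.
have cf : f t @[t --> G] --> f s.
  by apply: wcvg_jip => //; apply: (@wcvg_linear _ _ _ _ _ _ _ (jmul A x) Gs).
have cw : (fun=> f w) @ G --> f w by apply: cvg_cst.
apply: (cvg_le cw cf).
by apply: FG; exists w => // t [].
Qed.

Lemma self_adjoint_eigenvector x W : W != 0%VS ->
  (forall w, w \in W -> x • w \in W) ->
  exists v l, [/\ v \in W, v != 0 & x • v = l *: v].
Proof.
move=> W0 xW; have [s [sW s1 smax]] := rayleigh_max x W0.
set l := ⟪x • s, s⟫ in smax; exists s, l; split=> //.
  by apply/eqP => s0; move/eqP: s1; rewrite s0 jip0l eq_sym oner_eq0.
have max w : w \in W -> ⟪x • w, w⟫ <= l * ⟪w, w⟫.
  move=> wW; have [->|w0] := eqVneq w 0; first by rewrite !jipr0 mulr0.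
  have /= := smax ((Num.sqrt ⟪w, w⟫)^-1 *: w).
  rewrite jip_normalize // memvZ // => /(_ isT erefl).
  rewrite jmulZr jipZl jipZr mulrA -invfM -expr2 sqr_sqrtr ?jip_ge0 //.
  by rewrite ler_pdivrMl ?jip_gt0 // mulrC.
pose r := l *: s - x • s.
have rW : r \in W by rewrite rpredB ?memvZ ?xW.
suff : ⟪r, r⟫ = 0 by move/eqP; rewrite jip_eq0 subr_eq0 => /eqP/esym.
(* The nonnegative form [l * ⟪w, w⟫ - ⟪x • w, w⟫] vanishes at [s]; its
   derivative at [s] in the direction [r] is then zero. *)
have rr w : ⟪r, w⟫ = l * ⟪s, w⟫ - ⟪x • s, w⟫ by rewrite jipDl jipNl jipZl.
clearbody r; have xsr : ⟪x • r, s⟫ = ⟪x • s, r⟫ by rewrite jip_selfadjoint jipC.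
set B := l * ⟪r, r⟫ - ⟪x • r, r⟫.
have B0 : 0 <= B by rewrite subr_ge0 max.
have := max (s - (⟪r, r⟫ / (B + 1)) *: r).
rewrite rpredB ?memvZ // => /(_ isT).
set t := ⟪r, r⟫ / (B + 1).
rewrite !(jmulDr, jmulNr, jmulZr, jipDl, jipNl, jipZl, jipDr, jipNr, jipZr).
rewrite xsr (jipC A r s) -/l s1 => H.
have e : t * (B + 1) = ⟪r, r⟫ by rewrite /t divfK // gt_eqF // ltr_wpDl.
have P : ⟪x • s, r⟫ = l * ⟪s, r⟫ - ⟪r, r⟫ by rewrite rr; ring.
have t20 : t * t * (B + 2) <= 0.
  have -> : t * t * (B + 2) = 2 * t * ⟪r, r⟫ - t * t * B by rewrite -e; ring.
  by move: H; rewrite P /B; lra.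
have : t * t <= 0 by rewrite -(pmulr_lle0 _ (_ : 0 < B + 2)) // ltr_wpDl.
by rewrite -expr2 exprn_even_le0 //= => /eqP t0; rewrite -e t0 mul0r.
Qed.

Lemma span_powers x : exists W, [/\ x \in W,
  forall w, w \in W -> x • w \in W &
  forall w, w \in W -> exists N (a : 'I_N -> R),
    w = \sum_i a i *: jpow A x i.+1].
Proof.
pose W N : {vspace V} := (\sum_(i < N) <[jpow A x i.+1]>)%VS.
have WS N : W N.+1 = (W N + <[jpow A x N.+1]>)%VS by rewrite /W big_ord_recr.
have [N WN] : exists N, W N.+1 = W N.
  have exd : exists d, `[< exists N, \dim (W N) = d >].
    by exists (\dim (W 0%N)); apply/asboolP; exists 0%N.
  have led d : `[< exists N, \dim (W N) = d >] -> (d <= \dim {:V})%N.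
    by move=> /asboolP[N <-]; rewrite dimvS ?subvf.
  case: (ex_maxnP exd led) => d /asboolP[N <-] max; exists N.
  apply/eqP; rewrite eq_sym eqEdim WS addvSl /= -WS.
  by apply: max; apply/asboolP; exists N.+1.
have powW i : (i <= N)%N -> jpow A x i.+1 \in W N.
  move=> iN; rewrite -WN; apply: subvP (memv_line _).
  exact: (sumv_sup (Ordinal (iN : i < N.+1)%N)).
have rep w : w \in W N -> exists a : 'I_N -> R, w = \sum_i a i *: jpow A x i.+1.
  move=> /memv_sumP[f fP ->].
  have /choice[a aP] i : exists a, f i = a *: jpow A x i.+1.
    by have /vlineP[a ->] := fP i isT; exists a.
  by exists a; apply: eq_bigr.
exists (W N); split.
- by rewrite -(jpow1 A x) powW.
- move=> w /rep[a ->]; rewrite jmul_sumr rpred_sum // => i _.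
  by rewrite jmulZr memvZ // -[x • _]/(jpow A x i.+2) powW.
- by move=> w /rep[a wE]; exists N, a.
Qed.

Definition orth_idem (T : finType) (c : T -> V) :=
  [/\ forall i, jidempotent A (c i), forall i, c i != 0 &
      forall i j, i != j -> c i • c j = 0].

(** An eigenvector [v] of the multiplication by [x] among the polynomials in
    [x] spans an ideal of them, so that a multiple [c] of [v] is idempotent;
    then [x - l *: c] is orthogonal to [c] and lies in a smaller algebra. *)
Lemma spectral_subalgebra S x :
  {in S &, forall a b, a • b \in S} -> x \in S ->
  exists (T : finType) (c : T -> V) (mu : T -> R),
    [/\ orth_idem c, forall i, c i \in S & x = \sum_i mu i *: c i].
Proof.
have [n] := ubnP (\dim S); elim: n S x => // n IH S x ltS mulS xS.
have [x0|x0] := eqVneq x 0.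
  exists void, (fun=> 0), (fun=> 0); split=> [|[]|]; first by split=> [[]|[]|[]].
  by rewrite x0 big1 // => [[]].
have [W [xW stabW repW]] := span_powers x.
have W0 : W != 0%VS by apply: contraNneq x0 => W0; rewrite -memv0 -W0.
have [v [l [vW v0 xv]]] := self_adjoint_eigenvector W0 stabW.
have [N [a vE]] := repW v vW.
have powv k : jpow A x k • v = l ^+ k *: v.
  elim: k => [|k IHk]; first by rewrite jmul1 scale1r.
  suff -> : jpow A x k.+1 • v = x • (jpow A x k • v).
    by rewrite IHk jmulZr xv scalerA exprSr.
  rewrite vE !jmul_sumr; apply: eq_bigr => i _.
  by rewrite !jmulZr !jpowD addSn.
pose mu := \sum_i a i * l ^+ i.+1.
have vv : v • v = mu *: v.
  rewrite {1}vE jmul_suml scaler_suml; apply: eq_bigr => i _.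
  by rewrite jmulZl powv scalerA.
have mu0 : mu != 0.
  apply: contraNneq v0 => mu0; rewrite -(jip_eq0 A).
  by rewrite -{1}(jmulr1 A v) jip_selfadjoint vv mu0 scale0r jipr0.
pose c := mu^-1 *: v.
have cc : jidempotent A c.
  by rewrite /jidempotent /c jmulZl jmulZr vv (scalerA _ mu) mulVf // scale1r.
have xc : x • c = l *: c by rewrite jmulZr xv !scalerA mulrC.
have powS i : jpow A x i.+1 \in S.
  by elim: i => [|i IHi]; [rewrite jpow1|apply: mulS].
have cS : c \in S by rewrite memvZ // vE rpred_sum // => i _; rewrite memvZ.
have c0 : c != 0 by rewrite scaler_eq0 invr_eq0 negb_or mu0.
pose S' := (S :&: lker (linfun (jmul A c)))%VS.
have S'P y : (y \in S') = (y \in S) && (c • y == 0).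
  by rewrite memv_cap memv_ker lfunE.
have [|y z||T [d [nu [[dd d0 dort] dS' xE]]]] := IH S' (x - l *: c).
- rewrite (leq_trans _ (ltS : (_ <= n)%N)) // ltnNge; apply/negP => le.
  have /eqP SS' : S' == S by rewrite eqEdim capvSl.
  by move: cS; rewrite -SS' S'P cc (negPf c0) andbF.
- rewrite !S'P => /andP[yS /eqP cy] /andP[zS /eqP cz].
  by rewrite mulS // (peirce_comm _ cc (i := 0)) ?cz ?jmulr0 ?eqxx ?scale0r.
- rewrite S'P; apply/andP; split; first by rewrite rpredB // (memvZ l cS).
  by rewrite jmulDr jmulNr jmulZr cc jmulC xc subrr.
have cd i : c • d i = 0 by have := dS' i; rewrite S'P => /andP[_ /eqP].
exists (option T), (oapp d c), (oapp nu l); split.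
- split=> [[i|]|[i|]|[i|] [j|]] //=; first exact: dort.
    by rewrite jmulC.
- by move=> [i|] //=; have := dS' i; rewrite S'P => /andP[].
by rewrite sum_option /= -xE addrC subrK.
Qed.

End Spectral.

(** * Order, norm and eigenvalues through quadratic forms *)

Section Forms.
Context (R : realType) (V : vectType R) (A : euclidean_jordan_algebra V).
Implicit Types (x y z v w c p s : V) (l : R) (T : finType).

Local Notation "x • y" := (jmul A x y) (at level 40, left associativity).
Local Notation "⟪ x , y ⟫" := (jip A x y) (format "⟪ x ,  y ⟫").
Local Notation u := (junit A).

Lemma orth_idem_mul T (c : T -> V) (P : pred T) t : orth_idem A c ->
  (\sum_(i | P i) c i) • c t = if P t then c t else 0.
Proof.
move=> [cc _ ort]; rewrite jmul_suml; case: ifPn => Pt.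
  by rewrite (bigD1 t) //= cc big1 ?addr0 // => i /andP[_ /ort].
by rewrite big1 // => i Pi; apply: ort; apply: contraNneq Pt => <-.
Qed.

Lemma orth_idem_sum_mul T (c : T -> V) (P Q : pred T) : orth_idem A c ->
  (\sum_(i | P i) c i) • (\sum_(i | Q i) c i) = \sum_(i | P i && Q i) c i.
Proof.
move=> oc; rewrite jmul_sumr -big_filter.
under eq_bigr do rewrite orth_idem_mul //.
by rewrite big_filter -big_mkcondr; apply: eq_bigl => i; rewrite andbC.
Qed.

Lemma orth_idem_sum T (c : T -> V) (P : pred T) : orth_idem A c ->
  jidempotent A (\sum_(i | P i) c i).
Proof.
move=> oc; rewrite /jidempotent orth_idem_sum_mul //.
by apply: eq_bigl => i; rewrite andbb.
Qed.

Lemma orth_idem_comb_mul T (c : T -> V) (mu : T -> R) t : orth_idem A c ->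
  (\sum_i mu i *: c i) • c t = mu t *: c t.
Proof.
move=> [cc _ ort]; rewrite jmul_suml (bigD1 t) //= jmulZl cc big1 ?addr0 //.
by move=> i it; rewrite jmulZl ort // scaler0.
Qed.

(** The idempotents of [spectral_subalgebra] are completed by the eigenvalue 0.
    Injectivity of [mu] is what ties the decomposition to [jeigenvalue] and to
    the degree of [x]. *)
Lemma spectral x p : jidempotent A p -> p • x = x ->
  exists T (c : T -> V) (mu : T -> R),
    [/\ orth_idem A c, \sum_i c i = p, x = \sum_i mu i *: c i & injective mu].
Proof.
move=> pp px; suff [T [c [mu [oc cp xE]]]] : exists T (c : T -> V) (mu : T -> R),
    [/\ orth_idem A c, \sum_i c i = p & x = \sum_i mu i *: c i].
  (* Grouping the terms that have the same coefficient. *)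
  pose I := Finite.clone (seq_sub (codom mu)) _.
  pose part (e : I) := \sum_(t | mu t == ssval e) c t.
  pose val_of t : I := SeqSub (codom_f mu t).
  have val_ofE t e : (mu t == ssval e) = (val_of t == e) by [].
  exists I, part, (fun e => ssval e); split.
  - split=> [e|e|e f ef]; first exact: orth_idem_sum.
      have /codomP[t mut] := ssvalP e; have [_ c0 _] := oc.
      apply: contra_neq (c0 t) => e0.
      have := orth_idem_mul (fun i => mu i == ssval e) t oc.
      by rewrite -/(part e) e0 jmul0l mut eqxx.
    rewrite orth_idem_sum_mul // big_pred0 // => t; apply/negP.
    by rewrite !val_ofE => /andP[/eqP-> /eqP fe]; rewrite fe eqxx in ef.
  - by rewrite -cp [RHS](partition_big val_of predT).
  - rewrite xE [LHS](partition_big val_of predT) //=.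
    apply: eq_bigr => e _; rewrite scaler_sumr; apply: eq_big => t.
      by rewrite val_ofE.
    by move=> /eqP<-.
  - exact: val_inj.
pose S := lker (linfun (jmul A p) - \1)%VF.
have SP y : (y \in S) = (p • y == y).
  by rewrite memv_ker add_lfunE opp_lfunE id_lfunE lfunE subr_eq0.
have [y z||T [c [mu [oc cS xE]]]] := @spectral_subalgebra _ _ A S x.
- rewrite !SP => /eqP py /eqP pz.
  by rewrite (peirce_comm _ pp (i := 1)) ?pz ?eqxx ?orbT ?scale1r.
- by rewrite SP px.
have pc i : p • c i = c i by have := cS i; rewrite SP => /eqP.
pose q := \sum_i c i; have pq : p • q = q.
  by rewrite jmul_sumr; apply: eq_bigr => i _; rewrite pc.
have qq : jidempotent A q by apply: orth_idem_sum.
have [pq0|pq0] := eqVneq (p - q) 0.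
  exists T, c, mu; split=> //; rewrite -/q; apply/esym/eqP.
  by rewrite -subr_eq0 pq0.
have qc i : (p - q) • c i = 0.
  by rewrite jmulDl jmulNl pc orth_idem_mul // subrr.
have [cc c0 ort] := oc.
exists (option T), (oapp c (p - q)), (oapp mu 0); split.
- split; last 1 first.
  + by move=> [i|] [j|] //= ij; [exact: ort|rewrite jmulC].
  + move=> [i|] /=; first exact: cc.
    by rewrite /jidempotent !jmulE (jmulC A q p) pq pp qq opprK addNr addr0.
  + by move=> [i|] /=.
- by rewrite sum_option /= subrK.
- by rewrite sum_option /= scale0r add0r.
Qed.

(** The quadratic form of the multiplication by [x] ([qformE]), written as the
    value of [x] at the state [s • s]. *)
Definition qform x s := ⟪x, s • s⟫.

Lemma qformE x s : qform x s = ⟪x • s, s⟫.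
Proof. by rewrite jmulC jip_selfadjoint. Qed.

Lemma qformD x y s : qform (x + y) s = qform x s + qform y s.
Proof. exact: jipDl. Qed.

Lemma qformN x s : qform (- x) s = - qform x s.
Proof. exact: jipNl. Qed.

Lemma qformB x y s : qform (x - y) s = qform x s - qform y s.
Proof. by rewrite qformD qformN. Qed.

Lemma qformZ l x s : qform (l *: x) s = l * qform x s.
Proof. exact: jipZl. Qed.

Lemma qform_sum (I : Type) (r : seq I) (P : pred I) (f : I -> V) s :
  qform (\sum_(i <- r | P i) f i) s = \sum_(i <- r | P i) qform (f i) s.
Proof. exact: jip_suml. Qed.

Lemma qform_scale x l s : qform x (l *: s) = l ^+ 2 * qform x s.
Proof. by rewrite /qform jmulZl jmulZr !jipZr mulrA. Qed.

Lemma qform_unit p s : p • s = s -> qform p s = ⟪s, s⟫.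
Proof. by rewrite qformE => ->. Qed.

Lemma qform_idem_ge0 c s : jidempotent A c -> 0 <= qform c s.
Proof. by rewrite qformE; apply: idem_form_ge0. Qed.

Lemma qform_idem_eq0 c s : jidempotent A c -> qform c s = 0 -> c • s = 0.
Proof. by rewrite qformE; apply: idem_form_eq0. Qed.

Lemma qform_comb T (c : T -> V) (mu : T -> R) t : orth_idem A c ->
  qform (\sum_i mu i *: c i) (c t) = mu t * ⟪c t, c t⟫.
Proof. by move=> oc; rewrite qformE orth_idem_comb_mul // jipZl. Qed.

Lemma qform_comb_le T (c : T -> V) (mu : T -> R) p s l : orth_idem A c ->
  \sum_i c i = p -> p • s = s -> (forall t, mu t <= l) ->
  qform (\sum_i mu i *: c i) s <= l * ⟪s, s⟫.
Proof.
move=> [cc _ _] cp ps mul; rewrite -(qform_unit ps) -cp !qform_sum mulr_sumr.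
by apply: ler_sum => t _; rewrite qformZ ler_wpM2r ?qform_idem_ge0.
Qed.

Lemma qform_normalize x c : c != 0 ->
  qform x ((Num.sqrt ⟪c, c⟫)^-1 *: c) = ⟪c, c⟫^-1 * qform x c.
Proof. by move=> c0; rewrite qform_scale exprVn sqr_sqrtr ?jip_ge0. Qed.

Lemma unit_idem : jidempotent A u.
Proof. exact: jmul1. Qed.

Lemma jconeP x : jcone A x <-> forall s, 0 <= qform x s.
Proof.
split=> [[y _ <-] s|x0].
  have [T [c [mu [oc _ -> _]]]] := spectral unit_idem (jmul1 A y).
  rewrite jmul_sumr qform_sum sumr_ge0 // => t _.
  rewrite jmulZr orth_idem_comb_mul // scalerA qformZ.
  by rewrite mulr_ge0 ?qform_idem_ge0 ?sqr_ge0 //; case: oc.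
have [T [c [mu [oc _ xE _]]]] := spectral unit_idem (jmul1 A x).
have [_ c0 _] := oc.
have mu0 t : 0 <= mu t.
  by have := x0 (c t); rewrite xE qform_comb // pmulr_lge0 ?jip_gt0.
exists (\sum_t Num.sqrt (mu t) *: c t) => //.
rewrite jmul_sumr xE; apply: eq_bigr => t _.
by rewrite jmulZr orth_idem_comb_mul // scalerA -expr2 sqr_sqrtr.
Qed.

Lemma arg_maxr_exists T (f : T -> R) (t0 : T) : exists t, forall i, f i <= f t.
Proof.
by case: (arg_maxP f (isT : predT t0)) => t _ max; exists t => i; apply: max.
Qed.

(** The spectral decompositions of [z] are compared through its quadratic form
    on the subalgebra: its values at the idempotents are the eigenvalues. *)
Lemma max_eigenvalueP p z : jidempotent A p -> p != 0 -> p • z = z ->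
  (forall s, p • s = s -> qform z s <= max_eigenvalue A p z * ⟪s, s⟫) /\
  (exists s, [/\ p • s = s, ⟪s, s⟫ = 1 & qform z s = max_eigenvalue A p z]).
Proof.
move=> pp p0 pz; have [T [c [mu [oc cp zE muI]]]] := spectral pp pz.
have [cc c0 ort] := oc.
have pc t : p • c t = c t by rewrite -cp orth_idem_mul.
have [t0 _] : exists t : T, true.
  apply: contrapT => T0; move/eqP: p0; apply; rewrite -cp big1 // => t _.
  by case: T0; exists t.
have {t0} [t tmax] := arg_maxr_exists mu t0.
have le s : p • s = s -> qform z s <= mu t * ⟪s, s⟫.
  by move=> ps; rewrite zE; apply: qform_comb_le ps tmax.
suff -> : max_eigenvalue A p z = mu t.
  split=> //; exists ((Num.sqrt ⟪c t, c t⟫)^-1 *: c t).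
  split; [by rewrite jmulZr pc|exact: jip_normalize|].
  by rewrite qform_normalize // zE qform_comb // mulrCA mulVf ?mulr1 ?jip_eq0.
have enumE (F : T -> V) : \sum_(i < #|T|) F (enum_val i) = \sum_i F i.
  by rewrite -big_enum_val; apply: eq_bigl.
have eig : jeigenvalue A p z (mu t).
  exists #|T|, (c \o enum_val), (mu \o enum_val); split=> /=.
  - by move=> i j /muI /enum_val_inj.
  - move=> i; split=> //; exists (c (enum_val i)) => //.
    by rewrite /quadrep pp !pc scalerDl scale1r addrK.
  - by move=> i j ij; apply: ort; rewrite (inj_eq enum_val_inj).
  - by rewrite -cp -enumE.
  - by rewrite zE -enumE; split=> //; exists (enum_rank t); rewrite enum_rankK.
have ub l : jeigenvalue A p z l -> l <= mu t.
  move=> [k [d [nu [_ dP dort dp [zd [i <-]]]]]].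
  have od : orth_idem A d by split=> // j; have [] := dP j.
  have [_ di di0] := dP i.
  have := le (d i); rewrite -{1}dp orth_idem_mul // zd qform_comb //.
  by move=> /(_ erefl); rewrite ler_pM2r // jip_gt0.
apply/eqP; rewrite eq_le; apply/andP; split.
  by apply: ge_sup; [exists (mu t)|exact: ub].
by apply: ub_le_sup => //; exists (mu t); exact: ub.
Qed.

Lemma jle_unorm x l :
  jle A (- (l *: u)) x /\ jle A x (l *: u) <->
  forall s, `|qform x s| <= l * ⟪s, s⟫.
Proof.
rewrite /jle !jconeP; split=> [[lo hi] s|bnd].
  have := lo s; have := hi s; rewrite opprK qformB qformD qformZ.
  by rewrite (qform_unit (jmul1 A s)) ler_norml => *; apply/andP; split; lra.
split=> s; have := bnd s; rewrite ?opprK ?qformB ?qformD qformZ;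
  by rewrite (qform_unit (jmul1 A s)) ler_norml => /andP[]; lra.
Qed.

Let unorm_set x : set R :=
  [set l | 0 <= l /\ jle A (- (l *: u)) x /\ jle A x (l *: u)].

Lemma unorm_min x l : 0 <= l -> (forall s, `|qform x s| <= l * ⟪s, s⟫) ->
  unorm A x <= l.
Proof.
move=> l0 /jle_unorm bnd; apply: ge_inf; last by split.
by exists 0 => m [].
Qed.

Lemma unorm_set_nonempty x : unorm_set x !=set0.
Proof.
have [T [c [mu [oc cp -> _]]]] := spectral unit_idem (jmul1 A x).
have le0 t : `|mu t| <= \sum_t `|mu t|.
  by rewrite (bigD1 t) //= lerDl sumr_ge0.
exists (\sum_t `|mu t|); split; first by rewrite sumr_ge0.
apply/jle_unorm => s; rewrite ler_norml lerNl -qformN -sumrN.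
have [cc _ _] := oc.
under eq_bigr do rewrite -scaleNr.
by rewrite !(qform_comb_le oc cp (jmul1 A s)) // => t;
  rewrite (le_trans _ (le0 t)) ?ler_norm // -normrN ler_norm.
Qed.

Lemma unorm_ge0 x : 0 <= unorm A x.
Proof. by apply: lb_le_inf; [exact: unorm_set_nonempty|move=> l []]. Qed.

Lemma unorm_bound x s : `|qform x s| <= unorm A x * ⟪s, s⟫.
Proof.
have [->|s0] := eqVneq s 0.
  by rewrite /qform !jipr0 jmulr0 jipr0 normr0 mulr0.
rewrite -ler_pdivrMr ?jip_gt0 //; apply: lb_le_inf => [|l [_ /jle_unorm bnd]].
  exact: unorm_set_nonempty.
by rewrite ler_pdivrMr ?jip_gt0.
Qed.

Lemma unormN x : unorm A (- x) = unorm A x.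
Proof.
wlog suff le : x / unorm A (- x) <= unorm A x.
  by apply/eqP; rewrite eq_le le -{1}[x]opprK le.
by apply: unorm_min (unorm_ge0 _) _ => s; rewrite qformN normrN unorm_bound.
Qed.

Lemma unormD x y : unorm A (x + y) <= unorm A x + unorm A y.
Proof.
apply: unorm_min => [|s]; first by rewrite addr_ge0 ?unorm_ge0.
rewrite qformD mulrDl (le_trans (ler_normD _ _)) //.
by rewrite lerD ?unorm_bound.
Qed.

Section Combination.
Context (T : finType) (c : T -> V) (mu : T -> R) (oc : orth_idem A c)
  (cu : \sum_t c t = u).

Lemma unorm_comb_ge t : `|mu t| <= unorm A (\sum_t mu t *: c t).
Proof.
have := unorm_bound (\sum_t mu t *: c t) (c t); have [_ c0 _] := oc.
by rewrite qform_comb // normrM (ger0_norm (jip_ge0 _ _)) ler_pM2r ?jip_gt0.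
Qed.

Lemma unorm_comb_le l : 0 <= l -> (forall t, `|mu t| <= l) ->
  unorm A (\sum_t mu t *: c t) <= l.
Proof.
move=> l0 mul; apply: unorm_min => // s; rewrite ler_norml lerNl -qformN -sumrN.
under eq_bigr do rewrite -scaleNr.
rewrite !(qform_comb_le oc cu (jmul1 A s)) // => t; have := mul t;
  by rewrite ler_norml => /andP[]; lra.
Qed.

Lemma unorm_comb_eq : u != 0 -> exists t, unorm A (\sum_t mu t *: c t) = `|mu t|.
Proof.
move=> u0; have [t0 _] : exists t : T, true.
  apply: contrapT => T0; move/eqP: u0; apply; rewrite -cu big1 // => t _.
  by case: T0; exists t.
have [t tmax] := arg_maxr_exists (fun t => `|mu t|) t0; exists t.
by apply/eqP; rewrite eq_le unorm_comb_ge unorm_comb_le.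
Qed.

End Combination.

Lemma unorm_attained x : u != 0 ->
  exists s, ⟪s, s⟫ = 1 /\ `|qform x s| = unorm A x.
Proof.
move=> u0; have [T [c [mu [oc cu xE _]]]] := spectral unit_idem (jmul1 A x).
have [t tE] := unorm_comb_eq mu oc cu u0; have [_ c0 _] := oc.
exists ((Num.sqrt ⟪c t, c t⟫)^-1 *: c t); split; first exact: jip_normalize.
rewrite qform_normalize // xE qform_comb // mulrCA mulVf ?mulr1 ?tE //.
by rewrite jip_eq0.
Qed.

End Forms.

(** * Rank and frames *)

Section Rank.
Context (R : realType) (V : vectType R) (A : euclidean_jordan_algebra V).
Implicit Types (x y z v w c p s : V) (l : R) (T : finType).

Local Notation "x • y" := (jmul A x y) (at level 40, left associativity).
Local Notation "⟪ x , y ⟫" := (jip A x y) (format "⟪ x ,  y ⟫").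
Local Notation u := (junit A).

Lemma jpow_comb T (c : T -> V) (mu : T -> R) n : orth_idem A c ->
  \sum_i c i = u ->
  jpow A (\sum_i mu i *: c i) n = \sum_i mu i ^+ n *: c i.
Proof.
move=> oc cu; elim: n => [|n IH].
  by rewrite /= -cu; apply: eq_bigr => i _; rewrite scale1r.
rewrite [LHS]iterS -/(jpow _ _ n) IH jmul_sumr; apply: eq_bigr => i _.
by rewrite jmulZr orth_idem_comb_mul // scalerA exprSr.
Qed.

Lemma jpowers_freeP x n :
  reflect (forall a : 'I_n -> R, \sum_i a i *: jpow A x i = 0 ->
             forall i, a i = 0)
          (free (jpowers A x n)).
Proof.
have -> : jpowers A x n = [tuple jpow A x i | i < n].
  by rewrite /jpowers -val_enum_ord -map_comp.
apply: (iffP freeP) => H a; last first.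
  move=> a0; apply: H; rewrite -[RHS]a0; apply: eq_bigr => i _.
  by rewrite -tnth_nth tnth_mktuple.
move=> a0; apply: H; rewrite -[RHS]a0; apply: eq_bigr => i _.
by rewrite -tnth_nth tnth_mktuple.
Qed.

Lemma jpowers_free_le x m n : (m <= n)%N ->
  free (jpowers A x n) -> free (jpowers A x m).
Proof.
move=> mn; rewrite /jpowers -(subnKC mn) iotaD map_cat; exact: catl_free.
Qed.

(** The coordinates of the powers of [x] on the idempotents form a Vandermonde
    matrix. *)
Lemma jdegree_comb T (c : T -> V) (mu : T -> R) : u != 0 -> orth_idem A c ->
  \sum_i c i = u -> injective mu -> jdegree A (\sum_i mu i *: c i) #|T|.
Proof.
move=> u0 oc cu muI; have [_ c0 _] := oc; set x := \sum_i _.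
have freeT : free (jpowers A x #|T|).
  apply/jpowers_freeP => a; under eq_bigr do rewrite jpow_comb //.
  move=> a0 i; pose P := \poly_(j < #|T|) (if insub j is Some k then a k else 0).
  have Pmu t : P.[mu t] = 0.
    have : (\sum_i a i *: \sum_t mu t ^+ i *: c t) • c t = 0 by rewrite a0 jmul0l.
    rewrite jmul_suml.
    under eq_bigr do rewrite jmulZl orth_idem_comb_mul // scalerA.
    rewrite -scaler_suml => /eqP.
    rewrite scaler_eq0 (negPf (c0 t)) orbF => /eqP H.
    by rewrite horner_poly -[RHS]H; apply: eq_bigr => j _; rewrite valK.
  have P0 : P = 0.
    apply/eqP/negPn/negP => /max_poly_roots H.
    have := H (codom mu); rewrite map_inj_uniq ?enum_uniq // size_codom.
    have -> : all (root P) (codom mu).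
      by apply/allP => _ /codomP[t ->]; apply/rootP.
    by move=> /(_ isT isT); rewrite ltnNge size_poly.
  by have := coef_poly #|T| (fun j => if insub j is Some k then a k else 0) i;
    rewrite -/P P0 coef0 ltn_ord valK.
split.
- rewrite lt0n; apply: contra u0 => /eqP/card0_eq T0.
  by rewrite -cu big1 // => t; have := T0 t; rewrite inE.
- apply/negP => /eqP; rewrite size_map size_iota => dim.
  have : (<<jpowers A x #|T|.+1>> <= <<codom c>>)%VS.
    apply/span_subvP => _ /mapP[j _ ->]; rewrite -/(jpow A x j) jpow_comb //.
    by rewrite rpred_sum // => t _; rewrite memvZ // memv_span // codom_f.
  move/dimvS; rewrite dim => /leq_trans/(_ (dim_span _)).
  by rewrite size_codom ltnn.
- by move=> j /andP[_ jT]; apply: jpowers_free_le freeT.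
Qed.

Lemma jpow_poly x y n (phi : V -> R) : scalar phi ->
  exists P : {poly R}, forall t, phi (jpow A (x + t *: y) n) = P.[t].
Proof.
elim: n phi => [|n IH] phi lphi.
  by exists (phi u)%:P => t; rewrite hornerC.
have lin z : scalar (fun v => phi (z • v)).
  by move=> l v w; rewrite jmulDr jmulZr lphi.
have [P PE] := IH _ (lin x); have [Q QE] := IH _ (lin y).
exists (P + 'X * Q) => t; rewrite !hornerE -PE -QE [jpow _ _ _]iterS.
by rewrite jmulDl jmulZl addrC lphi addrC.
Qed.

(** Linear independence of the powers up to the degree of [x0] is the
    nonvanishing of a determinant that is polynomial on the line through [x]
    and [x0], and equal to 1 at [x0]. *)
Lemma generic_free x x0 n : free (jpowers A x0 n) ->
  exists2 D : {poly R}, D != 0 &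
    forall t, D.[t] != 0 -> free (jpowers A (x + t *: (x0 - x)) n).
Proof.
move=> fr; pose X := [tuple jpow A x0 i | i < n].
have XE : jpowers A x0 n = X by rewrite /jpowers -val_enum_ord -map_comp.
have /choice[P PE] ij : exists P : {poly R}, forall t,
    coord X ij.1 (jpow A (x + t *: (x0 - x)) (ij.2 : 'I_n)) = P.[t].
  by apply: jpow_poly => l v w; rewrite linearP.
pose M : 'M[{poly R}]_n := \matrix_(i, j) P (i, j).
have ME t : (\det M).[t] = \det (\matrix_(i, j) (P (i, j)).[t]).
  rewrite -[LHS]/(horner_eval t (\det M)) -det_map_mx; congr (\det _).
  by apply/matrixP => i j; rewrite !mxE.
exists (\det M) => [|t].
  have : (\det M).[1] = 1.
    rewrite ME -[RHS](det1 R n); congr (\det _); apply/matrixP => i j.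
    rewrite !mxE -PE /= scale1r addrC subrK.
    have -> : jpow A x0 j = X`_j by rewrite -tnth_nth tnth_mktuple.
    by rewrite coord_free -?XE // eq_sym.
  by apply: contra_eq_neq => ->; rewrite horner0 eq_sym oner_neq0.
rewrite ME => D0; apply/jpowers_freeP => a a0.
set N := (X in \det X) in D0.
have Na : N *m (\col_j a j) = 0.
  apply/colP => i; rewrite !mxE -[RHS](linear0 (coord X i)) -a0 linear_sum /=.
  by apply: eq_bigr => j _; rewrite linearZ !mxE -PE mulrC.
have Nu : N \in unitmx by rewrite unitmxE unitfE.
move=> i; have := congr1 (fun b : 'cV_n => (invmx N *m b) i 0) Na.
by rewrite mulmxA mulVmx // mul1mx mulmx0 !mxE.
Qed.

Lemma poly_small_nonroot (D : {poly R}) (e : R) : D != 0 -> 0 < e ->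
  exists t, 0 < t < e /\ D.[t] != 0.
Proof.
move=> D0 e0; apply: contrapT => H.
have root t : 0 < t < e -> root D t.
  by move=> te; apply/negPn/negP => tD; apply: H; exists t.
pose f (i : nat) : R := e / i.+2%:R.
have fI : injective f.
  move=> i j /(mulfI (lt0r_neq0 e0))/invr_inj/eqP.
  by rewrite eqr_nat => /eqP[].
have := max_poly_roots D0 (rs := map f (iota 0 (size D))).
rewrite map_inj_uniq // iota_uniq size_map size_iota ltnn => H'.
have /negP : ~~ false by []; apply; apply: H' => //.
apply/allP => _ /mapP[i _ ->]; apply: root; rewrite divr_gt0 ?ltr0n //=.
by rewrite ltr_pdivrMr ?ltr0n // ltr_pMr // ltr1n.
Qed.

End Rank.

Section Frames.
Context (R : realType) (V : vectType R) (A : euclidean_jordan_algebra V).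
Implicit Types (x y z v w c p s : V) (l : R) (T : finType).

Local Notation "x • y" := (jmul A x y) (at level 40, left associativity).
Local Notation "⟪ x , y ⟫" := (jip A x y) (format "⟪ x ,  y ⟫").
Local Notation u := (junit A).

Lemma orth_idem_bound T (c : T -> V) i : orth_idem A c -> \sum_i c i = u ->
  ⟪c i, c i⟫ <= ⟪u, u⟫.
Proof.
move=> oc cu; have [cc _ _] := oc; rewrite -{1}cu jip_suml (bigD1 i) //=.
have -> : ⟪c i, c i⟫ = ⟪c i, u⟫.
  by rewrite -{2}(jmulr1 A (c i)) -jip_selfadjoint cc.
rewrite lerDl sumr_ge0 // => j _.
by rewrite -[X in ⟪_, X⟫](jmulr1 A u) -/(qform A _ _) qform_idem_ge0.
Qed.

(** A limit [p] of nonzero idempotents is not 0: it fixes a limit of the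
    normalized idempotents. *)
Lemma idem_limit_neq0 (I : Type) (F : set_system I) (FU : UltraFilter F)
    (c : I -> V) p : (forall t, jidempotent A (c t)) -> (forall t, c t != 0) ->
  wcvg A F c p -> p != 0.
Proof.
move=> cc c0 cp; have FP := @ultra_proper _ _ FU.
pose d t := (Num.sqrt ⟪c t, c t⟫)^-1 *: c t.
have d1 t : ⟪d t, d t⟫ = 1 by apply: jip_normalize.
have [e de] : exists e, wcvg A F d e.
  apply: (ultra_bounded_wcvg FU (C := 1)).
  by apply: filterE => t /=; rewrite d1.
have ee : ⟪e, e⟫ = 1.
  have dd : ⟪d t, d t⟫ @[t --> F] --> ⟪e, e⟫ by apply: wcvg_jip.
  have d1' : ⟪d t, d t⟫ @[t --> F] --> (1 : R).
    by under eq_cvg do rewrite d1; apply: cvg_cst.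
  exact: cvg_unique dd d1'.
have cd : wcvg A F d (p • e).
  have -> : d = fun t => c t • d t by apply/funext => t; rewrite jmulZr cc.
  exact: wcvg_jmul.
apply/eqP => p0; have := wcvg_unique de cd; rewrite p0 jmul0l => e0.
by move/eqP: ee; rewrite e0 jip0l eq_sym oner_eq0.
Qed.

Lemma orth_idem_limit T (I : Type) (F : set_system I) (FU : UltraFilter F)
    (q : I -> T -> V) :
  (forall t, orth_idem A (q t)) -> (forall t, \sum_i q t i = u) ->
  exists p : T -> V, [/\ forall i, wcvg A F (q^~ i) (p i), orth_idem A p &
                         \sum_i p i = u].
Proof.
move=> oq qu; have FP := @ultra_proper _ _ FU.
have /choice[p qp] i : exists p, wcvg A F (q^~ i) p.
  apply: (ultra_bounded_wcvg FU (C := ⟪u, u⟫)).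
  by apply: filterE => t /=; apply: orth_idem_bound.
have lim_eq v w (f g : I -> V) : wcvg A F f v -> wcvg A F g w -> f = g -> v = w.
  by move=> fv gw fg; apply: (wcvg_unique fv); rewrite fg.
have cst v : wcvg A F (fun=> v) v by apply: wcvg_cst.
exists p; split=> //; first split.
- move=> i; apply: (lim_eq _ _ _ _ (wcvg_jmul (qp i) (qp i)) (qp i)).
  by apply/funext => t; have [cc _ _] := oq t; exact: cc.
- move=> i; apply: (idem_limit_neq0 FU _ _ (qp i)) => t;
    by have [cc c0 _] := oq t.
- move=> i j ij; apply: (lim_eq _ _ _ _ (wcvg_jmul (qp i) (qp j)) (cst 0)).
  by apply/funext => t; have [_ _ ort] := oq t; apply: ort.
- apply: (lim_eq _ _ _ _ (wcvg_sum (fun i _ => qp i)) (cst u)).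
  by apply/funext => t; apply: qu.
Qed.

Lemma jordan_frame_orth_idem r (p : 'I_r -> V) :
  jordan_frame A p -> orth_idem A p /\ \sum_i p i = u.
Proof.
by move=> [prim ort pu]; split=> //; split=> // i; have [] := prim i.
Qed.

Context (r : nat) (rank_r : jrank A r) (u0 : u != 0).

Lemma orth_idem_card T (c : T -> V) : orth_idem A c -> \sum_i c i = u ->
  (#|T| <= r)%N.
Proof.
move=> oc cu; have [_ max] := rank_r.
pose mu (i : T) : R := (enum_rank i)%:R.
apply: max; apply: (jdegree_comb (mu := mu) u0 oc cu) => i j /eqP.
by rewrite eqr_nat => /eqP/val_inj/enum_rank_inj.
Qed.

(** A decomposition of a frame element into two idempotents would extend the
    frame to more than [r] orthogonal idempotents. *)
Lemma orth_idem_frame (p : 'I_r -> V) : orth_idem A p -> \sum_i p i = u ->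
  jordan_frame A p.
Proof.
move=> [pp p0 ort] pu; split=> // i; split=> // -[d [e [dd ee d0 e0 pE]]].
have de : d • e = 0.
  have := pp i; rewrite /jidempotent pE !jmulE dd ee (jmulC A e d) => H.
  apply: jip_inj => z; have := congr1 (fun v => ⟪v, z⟫) H.
  by rewrite !jipDl jip0l; lra.
have sub f : (f = d) \/ (f = e) -> forall j, j != i -> f • p j = 0.
  move=> fE j ji; have pf : p i • f = f.
    rewrite pE jmulDl; case: fE => ->;
      by rewrite ?dd ?ee ?(jmulC A e d) de ?addr0 ?add0r.
  have := peirce_comm (p j) (pp i) (i := 1) (a := f); rewrite eqxx orbT scale1r.
  move=> /(_ isT pf) H.
  have := peirce_comm f (pp i) (i := 0) (a := p j); rewrite eqxx scale0r.
  rewrite ort 1?eq_sym // => /(_ isT erefl); rewrite pf (jmulC A (p j)) H => <-.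
  by rewrite ort 1?eq_sym // jmulr0.
pose c (o : option 'I_r) := if o is Some j then if j == i then d else p j else e.
suff : (#|{: option 'I_r}| <= r)%N by rewrite card_option card_ord ltnn.
apply: (@orth_idem_card _ c).
  split.
  - by move=> [j|] //=; case: ifP => _; [exact: dd|exact: pp].
  - by move=> [j|] //=; case: ifP => _; [exact: d0|exact: p0].
  case=> [j|] [k|] //=.
  - rewrite (inj_eq Some_inj) => jk; case: (eqVneq j i) => [ji|ji].
      by rewrite ifN ?sub //; [left|rewrite -ji eq_sym|rewrite -ji eq_sym].
    by case: eqP => [_|_]; [rewrite jmulC sub //; left|apply: ort].
  - by move=> _; case: eqVneq => [_|ji]; [|rewrite jmulC sub //; right].
  - by move=> _; case: eqVneq => [_|ji]; [rewrite jmulC|rewrite sub //; right].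
rewrite sum_option /= -pu [RHS](bigD1 i) //= (bigD1 i) //= eqxx addrA pE.
rewrite (addrC e); congr (_ + _); apply: eq_bigr => j /negPf ji.
by rewrite ji.
Qed.

(** Elements of degree [r] have frames with [r] elements, they are dense, and
    limits of frames are frames. *)
Lemma frame_decomposition x : exists (q : 'I_r -> V) (mu : 'I_r -> R),
  [/\ orth_idem A q, \sum_i q i = u & x = \sum_i mu i *: q i].
Proof.
have [[x0 deg0] _] := rank_r.
have free0 : free (jpowers A x0 r).
  case: deg0 => r0 _ /(_ r.-1); case: (r) r0 => // -[|n] _ fr; last first.
    by apply: fr; rewrite /= ltnSn.
  by apply/jpowers_freeP => a; rewrite big_ord1 => /eqP;
    rewrite scaler_eq0 (negPf u0) orbF => /eqP a0 i; rewrite ord1.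
have free_frame y : free (jpowers A y r) ->
    exists (q : 'I_r -> V) (mu : 'I_r -> R),
    [/\ orth_idem A q, \sum_i q i = u & y = \sum_i mu i *: q i].
  move=> fr.
  have [T [c [mu [oc cu yE muI]]]] := spectral (unit_idem A) (jmul1 A y).
  have Tr : r = #|T|.
    apply/eqP; rewrite eqn_leq (orth_idem_card oc cu) andbT leqNgt.
    apply/negP => lt.
    have [_ /negP nf _] := jdegree_comb u0 oc cu muI; apply: nf.
    by rewrite -yE; apply: jpowers_free_le fr.
  pose h (i : 'I_r) := enum_val (cast_ord Tr i).
  have hI : injective h by move=> i j /enum_val_inj/cast_ord_inj.
  have hE (F : T -> V) : \sum_i F (h i) = \sum_i F i.
    rewrite [RHS](reindex h) //.
    exists (fun i => cast_ord (esym Tr) (enum_rank i)) => i _; rewrite /h.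
      by rewrite enum_valK cast_ordK.
    by rewrite cast_ordKV enum_rankK.
  have [cc c0 ort] := oc; exists (c \o h), (mu \o h); split.
  - by split=> [i|i|i j ij] /=; [exact: cc|exact: c0|rewrite ort // inj_eq].
  - by rewrite hE.
  - by rewrite yE -hE.
have [q0 [mu0 [oq0 qu0 _]]] := free_frame _ free0.
have [D D0 Dfree] := generic_free x free0.
pose y t := x + t *: (x0 - x).
have /choice[q] t : exists q : 'I_r -> V, [/\ orth_idem A q, \sum_i q i = u &
    D.[t] != 0 -> exists mu : 'I_r -> R, y t = \sum_i mu i *: q i].
  have [Dt|/Dfree/free_frame[q [mu [oq qu yE]]]] := eqVneq D.[t] 0.
    by exists q0; split=> //.
  by exists q; split=> // _; exists mu.
move=> /all_and3[oq qu qy].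
pose F := filter_from [set e : R | 0 < e]
  (fun e => [set t | 0 < t < e /\ D.[t] != 0]).
have FF : ProperFilter F.
  apply: filter_from_proper => [|e e0]; last first.
    by have [t tP] := poly_small_nonroot D0 e0; exists t.
  apply: filter_from_filter; first by exists 1; exact: ltr01.
  move=> d e d0 e0; exists (Num.min d e); first by rewrite /= lt_min d0.
  move=> t /= [/andP[t0]]; rewrite lt_min => /andP[td te] Dt.
  by rewrite t0 td te.
have [G [GU FG]] := ultraFilterLemma FF; have GP := @ultra_proper _ _ GU.
have [p [qp op pu]] := orth_idem_limit GU oq qu.
have t0 : (fun t : R => t) @ G --> (0 : R).
  apply/cvgrPdist_lt => e e0; apply: FG; exists e => // t /= [/andP[t0 te] _].
  by rewrite sub0r normrN gtr0_norm.
have yx : wcvg A G y x.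
  rewrite -[x]addr0 -(scale0r (x0 - x)); apply: wcvgD; first exact: wcvg_cst.
  by apply: wcvgZ => //; apply: wcvg_cst.
exists p, (fun i => ⟪x, p i⟫ / ⟪p i, p i⟫); split=> //.
apply: (wcvg_unique yx).
have lim : wcvg A G (fun t => \sum_i (⟪y t, q t i⟫ / ⟪q t i, q t i⟫) *: q t i)
    (\sum_i (⟪x, p i⟫ / ⟪p i, p i⟫) *: p i).
  apply: wcvg_sum => i _; apply: wcvgZ => //; apply: cvgM; first exact: wcvg_jip.
  apply: cvgV; last exact: wcvg_jip.
  by rewrite jip_eq0; have [_ p0 _] := op.
move=> z; apply: cvg_trans (lim z); apply: near_eq_cvg.
apply: FG; exists 1 => [|t /= [_ /qy[mu yE]]]; first exact: ltr01.
congr (⟪_, z⟫); rewrite {2}yE.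
apply: eq_bigr => i _; congr (_ *: _); have [_ c0 _] := oq t.
have [cc _ _] := oq t; rewrite yE.
rewrite -{1}(cc i) -jip_selfadjoint jmulC orth_idem_comb_mul // jipZl mulfK //.
by rewrite jip_eq0.
Qed.

End Frames.

(** * Limits of distance functions along frames *)

Section FrameHoro.
Context (R : realType) (V : vectType R) (A : euclidean_jordan_algebra V).
Implicit Types (x y z v w c s : V) (l : R).

Local Notation "x • y" := (jmul A x y) (at level 40, left associativity).
Local Notation "⟪ x , y ⟫" := (jip A x y) (format "⟪ x ,  y ⟫").
Local Notation u := (junit A).

Lemma quadrep_idemE p y : jidempotent A p ->
  quadrep A p y = 2 *: (p • (p • y)) - p • y.
Proof. by rewrite /quadrep => ->. Qed.

Lemma quadrepN p y : quadrep A p (- y) = - quadrep A p y.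
Proof. by rewrite /quadrep !jmulNr scalerN opprD. Qed.

Lemma quadrep_fixed p y : jidempotent A p ->
  p • quadrep A p y = quadrep A p y.
Proof.
move=> pp; rewrite quadrep_idemE // !jmulE; apply: jip_inj => z.
by have := congr1 (fun v => ⟪v, z⟫) (idem_cubic y pp); rewrite !jipE; lra.
Qed.

Lemma quadrep_id p s : jidempotent A p -> p • s = s -> quadrep A p s = s.
Proof. by move=> pp ps; rewrite quadrep_idemE // !ps scalerDl scale1r addrK. Qed.

Lemma qform_quadrep p x s : jidempotent A p -> p • s = s ->
  qform A (quadrep A p x) s = qform A x s.
Proof.
move=> pp ps; have pss : p • (s • s) = s • s.
  by rewrite (peirce_comm _ pp (i := 1)) ?ps ?eqxx ?orbT ?scale1r.
rewrite quadrep_idemE // qformB qformZ /qform !jip_selfadjoint !pss; ring.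
Qed.

Context (r : nat).
Implicit Types (p q : 'I_r -> V) (I J : {set 'I_r}) (alpha a : 'I_r -> R).

Lemma frame_sum_idem p I : orth_idem A p -> jidempotent A (frame_sum p I).
Proof. exact: orth_idem_sum. Qed.

Lemma frame_sum_mul p I i : orth_idem A p ->
  frame_sum p I • p i = if i \in I then p i else 0.
Proof. exact: orth_idem_mul. Qed.

Lemma frame_sum_eq0 p I : orth_idem A p ->
  (frame_sum p I == 0) = (I == finset.set0).
Proof.
move=> op; apply/eqP/eqP => [p0|->]; last by rewrite /frame_sum big_set0.
apply/setP => i; rewrite inE; apply/negP => iI; have [_ nz _] := op.
by have := frame_sum_mul I i op; rewrite p0 jmul0l iI => /esym/eqP; apply/negP.
Qed.

Lemma frame_sum_fixed0 p I s i : orth_idem A p -> frame_sum p I • s = s ->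
  i \notin I -> p i • s = 0.
Proof.
move=> op ps iI; have pp := frame_sum_idem I op.
have pi0 : frame_sum p I • p i = 0 by rewrite frame_sum_mul // (negPf iI).
have := peirce_comm s pp (i := 0) (a := p i); rewrite eqxx scale0r pi0.
move=> /(_ isT erefl); rewrite ps => <-.
have := peirce_comm (p i) pp (i := 1) (a := s); rewrite eqxx orbT scale1r pi0.
by rewrite jmulr0 (jmulC A (p i) s) => /(_ isT ps).
Qed.

Lemma frame_sum_fixedP p I s : orth_idem A p -> \sum_i p i = u ->
  (forall i, i \notin I -> p i • s = 0) -> frame_sum p I • s = s.
Proof.
move=> op pu H; rewrite -[RHS](jmul1 A) -pu /frame_sum !jmul_suml.
rewrite [RHS](bigID (mem I)) /=.
by rewrite [X in _ + X]big1 ?addr0.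
Qed.

(** The quadratic form of [U_p x - \sum_i alpha i *: p i] on the subalgebra of
    [p], for [p] the sum of the [p i]. *)
Definition penalized p I alpha x s :=
  qform A x s - \sum_(i in I) alpha i * qform A (p i) s.

Lemma max_eigenvalue_frame p I alpha x : orth_idem A p -> I != finset.set0 ->
  let L := max_eigenvalue A (frame_sum p I)
    (quadrep A (frame_sum p I) x - \sum_(i in I) alpha i *: p i) in
  (forall s, frame_sum p I • s = s -> penalized p I alpha x s <= L * ⟪s, s⟫) /\
  (exists s, [/\ frame_sum p I • s = s, ⟪s, s⟫ = 1 & penalized p I alpha x s = L]).
Proof.
move=> op I0 /=; have pp := frame_sum_idem I op.
set z := quadrep A _ x - _; have pz : frame_sum p I • z = z.
  rewrite jmulDr jmulNr quadrep_fixed // jmul_sumr; congr (_ - _).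
  by apply: eq_bigr => i iI; rewrite jmulZr frame_sum_mul // iI.
have zE s : frame_sum p I • s = s -> qform A z s = penalized p I alpha x s.
  move=> ps; rewrite qformB qform_quadrep // qform_sum; congr (_ - _).
  by apply: eq_bigr => i _; rewrite qformZ.
have p0 : frame_sum p I != 0 by rewrite frame_sum_eq0.
have [le [s [ps s1 sE]]] := max_eigenvalueP pp p0 pz.
split=> [t pt|]; first by rewrite -zE // le.
by exists s; split=> //; rewrite -zE.
Qed.

Section Bounds.
Context p I J alpha (op : orth_idem A p) (IJ : horo_data I J alpha) (x : V).

Lemma frame_horo_geJ s : frame_sum p J • s = s ->
  penalized p J alpha x s <= frame_horo A p I J alpha x * ⟪s, s⟫.
Proof.
rewrite /frame_horo; have [J0|J0] := eqVneq J finset.set0.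
  move=> ps; have -> : s = 0.
    by rewrite -ps J0 /frame_sum big_set0 jmul0l.
  by rewrite /penalized J0 big_set0 /qform !jipr0 jmulr0 jipr0 subr0 mulr0.
have [le _] := max_eigenvalue_frame alpha x op J0.
move=> ps; case: ifP => _; first exact: le.
by apply: le_trans (le s ps) _; rewrite ler_wpM2r ?jip_ge0 // le_max lexx orbT.
Qed.

Lemma frame_horo_geI s : frame_sum p I • s = s ->
  penalized p I alpha (- x) s <= frame_horo A p I J alpha x * ⟪s, s⟫.
Proof.
rewrite /frame_horo -quadrepN; have [I0|I0] := eqVneq I finset.set0.
  move=> ps; have -> : s = 0.
    by rewrite -ps I0 /frame_sum big_set0 jmul0l.
  by rewrite /penalized I0 big_set0 /qform !jipr0 jmulr0 jipr0 subr0 mulr0.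
have [le _] := max_eigenvalue_frame alpha (- x) op I0.
move=> ps; case: ifP => _; first exact: le.
by apply: le_trans (le s ps) _; rewrite ler_wpM2r ?jip_ge0 // le_max lexx.
Qed.

Lemma frame_horo_attained : exists s, ⟪s, s⟫ = 1 /\
  ((frame_sum p J • s = s /\
    penalized p J alpha x s = frame_horo A p I J alpha x) \/
   (frame_sum p I • s = s /\
    penalized p I alpha (- x) s = frame_horo A p I J alpha x)).
Proof.
have [_ IJ0 _ _] := IJ; rewrite /frame_horo -quadrepN.
case: eqVneq => [I0|I0].
  have J0 : J != finset.set0 by move: IJ0; rewrite I0 finset.set0U.
  have [_ [s [ps s1 sE]]] := max_eigenvalue_frame alpha x op J0.
  by exists s; split=> //; left.
have [_ [s [ps s1 sE]]] := max_eigenvalue_frame alpha (- x) op I0.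
case: eqVneq => [J0|J0]; first by exists s; split=> //; right.
have [_ [t [pt t1 tE]]] := max_eigenvalue_frame alpha x op J0.
rewrite /Num.max; case: ifP => _; first by exists t; split=> //; left.
by exists s; split=> //; right.
Qed.

End Bounds.

Section Limit.
Context (X : Type) (F : set_system X) (FU : UltraFilter F).
Context (q : X -> 'I_r -> V) (p : 'I_r -> V).
Context (oq : forall t, orth_idem A (q t)) (qu : forall t, \sum_i q t i = u).
Context (op : orth_idem A p) (pu : \sum_i p i = u).
Context (qp : forall i, wcvg A F (q^~ i) (p i)).

Let FP : ProperFilter F := @ultra_proper _ _ FU.

Section OneSide.
Context (a : X -> 'I_r -> R) (J : {set 'I_r}) (alpha : 'I_r -> R) (x : V)
  (h : X -> R) (l : R).
Context (aJ : forall i, i \in J -> a t i @[t --> F] --> alpha i).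
Context (hl : h t @[t --> F] --> l).

Lemma cvg_penalized (f : X -> V) s : wcvg A F f s ->
  penalized (q t) J (a t) x (f t) @[t --> F] --> penalized p J alpha x s.
Proof.
move=> fs; have ff : wcvg A F (fun t => f t • f t) (s • s) by apply: wcvg_jmul.
apply: cvgB; first by apply: wcvg_jip => //; apply: wcvg_cst.
apply: cvg_big => [|i iJ]; first exact: add_continuous.
by apply: cvgM; [exact: aJ|apply: wcvg_jip].
Qed.

(** Where the weights [a t i] tend to infinity, the boundedness of [h] forces
    the forms of the [q t i] to vanish in the limit. *)
Lemma limit_upper (f : X -> V) :
  (forall t i, 0 <= a t i) ->
  (forall i, i \notin J -> forall M, F [set t | M <= a t i]) ->
  (forall t, ⟪f t, f t⟫ = 1) ->
  F [set t | h t = qform A x (f t) - \sum_i a t i * qform A (q t i) (f t)] ->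
  exists s, [/\ ⟪s, s⟫ = 1, frame_sum p J • s = s &
                l <= penalized p J alpha x s].
Proof.
move=> a0 aoo f1 hE.
have [s fs] : exists s, wcvg A F f s.
  apply: (ultra_bounded_wcvg FU (C := 1)).
  by apply: filterE => t /=; rewrite f1.
have ff : wcvg A F (fun t => f t • f t) (s • s) by apply: wcvg_jmul.
have term0 t i : 0 <= a t i * qform A (q t i) (f t).
  by rewrite mulr_ge0 // qform_idem_ge0 //; have [cc _ _] := oq t.
exists s; split.
- have fsc : ⟪f t, f t⟫ @[t --> F] --> ⟪s, s⟫ by apply: wcvg_jip.
  have f1c : ⟪f t, f t⟫ @[t --> F] --> (1 : R).
    by under eq_cvg do rewrite f1; apply: cvg_cst.
  exact: cvg_unique fsc f1c.
- apply: frame_sum_fixedP => // i iJ; have [pp _ _] := op.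
  apply: qform_idem_eq0 => //; apply/eqP; rewrite eq_le qform_idem_ge0 // andbT.
  rewrite leNgt; apply/negP; set e := qform A (p i) s => e0.
  have qe : qform A (q t i) (f t) @[t --> F] --> e by apply: wcvg_jip.
  have /(cvgr_gt _ qe) Fe : e / 2 < e by lra.
  have /(cvgr_gt _ hl) Fl : l - 1 < l by lra.
  pose C := unorm A x - l + 1.
  have Fa := aoo i iJ (2 * (`|C| + 1) / e).
  have [t /= [[[hE' Fe'] Fl'] Fa']] :=
    filter_ex (filterI (filterI (filterI hE Fe) Fl) Fa).
  have := unorm_bound A x (f t); rewrite f1 mulr1 ler_norml => /andP[_ xle].
  have : a t i * qform A (q t i) (f t) <= C.
    have : \sum_i a t i * qform A (q t i) (f t) <= C by rewrite /C; lra.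
    by apply: le_trans; rewrite [leRHS](bigD1 i) //= lerDl sumr_ge0.
  apply/negP; rewrite -ltNge; apply: le_lt_trans (ler_norm C) _.
  apply: lt_le_trans (_ : `|C| + 1 <= _); first by rewrite ltrDl.
  have -> : `|C| + 1 = (2 * (`|C| + 1) / e) * (e / 2).
    by field; rewrite gt_eqF.
  apply: ler_pM Fa' (ltW Fe'); last by rewrite divr_ge0 // ltW.
  by rewrite divr_ge0 ?(ltW e0) // mulr_ge0 // addr_ge0.
- apply: (cvg_le hl (cvg_penalized fs)); apply: filterS hE => t /= ->.
  by rewrite lerB // [leRHS](bigID (mem J)) /= lerDl sumr_ge0.
Qed.

(** Test vectors of the limit are pushed into the subalgebras of the [q t] by
    the quadratic representation, which kills the infinite weights. *)
Lemma limit_lower s :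
  (forall t v, qform A x v - \sum_i a t i * qform A (q t i) v <= h t * ⟪v, v⟫) ->
  ⟪s, s⟫ = 1 -> frame_sum p J • s = s -> penalized p J alpha x s <= l.
Proof.
move=> le s1 ps; pose f t := quadrep A (frame_sum (q t) J) s.
have qJ : wcvg A F (fun t => frame_sum (q t) J) (frame_sum p J).
  by apply: wcvg_sum => i _; apply: qp.
have fs : wcvg A F f s.
  rewrite -(quadrep_id (frame_sum_idem J op) ps) /f /quadrep.
  have cs : wcvg A F (fun=> s) s by apply: wcvg_cst.
  apply: wcvgB; last by apply: wcvg_jmul => //; apply: wcvg_jmul.
  apply: wcvgZ; first exact: cvg_cst.
  by apply: wcvg_jmul => //; apply: wcvg_jmul.
have hfl : h t * ⟪f t, f t⟫ @[t --> F] --> l.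
  by rewrite -[l]mulr1 -s1; apply: cvgM => //; apply: wcvg_jip.
apply: (cvg_le (cvg_penalized fs) hfl); apply: filterE => t /=.
apply: le_trans (le t (f t)); rewrite lerB //.
rewrite [leLHS](bigID (mem J)) /= [X in _ + X]big1 ?addr0 // => i iJ.
rewrite qformE (frame_sum_fixed0 (oq t) _ iJ) ?jip0l ?mulr0 //.
by rewrite quadrep_fixed //; apply: frame_sum_idem.
Qed.

End OneSide.

Lemma hfunE y x : hfun A y x = unorm A (x - y) - unorm A y.
Proof. by []. Qed.

Lemma hfun_bound y x : `|hfun A y x| <= unorm A x.
Proof.
rewrite hfunE ler_norml; apply/andP; split.
  have := unormD A (y - x) x; rewrite subrK -(unormN A (y - x)) opprB; lra.
by have := unormD A x (- y); rewrite unormN; lra.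
Qed.

Lemma frame_horo_limit (mu : X -> 'I_r -> R) (I J : {set 'I_r})
    (alpha : 'I_r -> R) (y : X -> V) x :
  (forall t, y t = \sum_i mu t i *: q t i) -> u != 0 -> horo_data I J alpha ->
  (forall i, i \in J -> unorm A (y t) + mu t i @[t --> F] --> alpha i) ->
  (forall i, i \notin J -> forall M, F [set t | M <= unorm A (y t) + mu t i]) ->
  (forall i, i \in I -> unorm A (y t) - mu t i @[t --> F] --> alpha i) ->
  (forall i, i \notin I -> forall M, F [set t | M <= unorm A (y t) - mu t i]) ->
  hfun A (y t) x @[t --> F] --> frame_horo A p I J alpha x.
Proof.
move=> ydef u0 IJ aJ aJ' bI bI'.
have [l hl] : exists l : R, hfun A (y t) x @[t --> F] --> l.
  apply: (ultra_bounded_cvg FU (C := unorm A x)).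
  by apply: filterE => t /=; apply: hfun_bound.
suff <- : l = frame_horo A p I J alpha x by [].
have nE t v : unorm A (y t) * ⟪v, v⟫ = \sum_i unorm A (y t) * qform A (q t i) v.
  by rewrite -mulr_sumr -qform_sum qu qform_unit // jmul1.
have yE t v : qform A (y t) v = \sum_i mu t i * qform A (q t i) v.
  by rewrite ydef qform_sum; apply: eq_bigr => i _; rewrite qformZ.
have aE t v : qform A x v - \sum_i (unorm A (y t) + mu t i) * qform A (q t i) v
    = qform A (x - y t) v - unorm A (y t) * ⟪v, v⟫.
  rewrite qformB nE yE; under eq_bigr do rewrite mulrDl.
  by rewrite big_split /=; ring.
have bE t v : qform A (- x) v - \sum_i (unorm A (y t) - mu t i) * qform A (q t i) v
    = - qform A (x - y t) v - unorm A (y t) * ⟪v, v⟫.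
  rewrite qformN qformB nE yE; under eq_bigr do rewrite mulrBl.
  by rewrite sumrB; ring.
have ge0 t i : 0 <= unorm A (y t) + mu t i /\ 0 <= unorm A (y t) - mu t i.
  have := unorm_comb_ge (mu t) (oq t) i.
  by rewrite -ydef ler_norml => /andP[]; split; lra.
apply/eqP; rewrite eq_le; apply/andP; split.
  have /choice[f fP] t : exists s, ⟪s, s⟫ = 1 /\
      `|qform A (x - y t) s| = unorm A (x - y t) by apply: unorm_attained.
  pose P := [set t | 0 <= qform A (x - y t) (f t)].
  have [FPos|FNeg] := in_ultra_setVsetC P FU.
    have [|||s [s1 ps le]] := limit_upper (x := x) aJ hl _ aJ' (f := f).
    - by move=> t i; have [] := ge0 t i.
    - by move=> t; have [] := fP t.
    - apply: filterS FPos => t /= pos; have [f1 fE] := fP t.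
      by rewrite aE f1 mulr1 hfunE -fE ger0_norm.
    by apply: le_trans le _; rewrite -[leRHS]mulr1 -s1 frame_horo_geJ.
  have [|||s [s1 ps le]] := limit_upper (x := - x) bI hl _ bI' (f := f).
  - by move=> t i; have [] := ge0 t i.
  - by move=> t; have [] := fP t.
  - apply: filterS FNeg => t /= /negP; rewrite -ltNge => neg; have [f1 fE] := fP t.
    by rewrite bE f1 mulr1 hfunE -fE ltr0_norm.
  by apply: le_trans le _; rewrite -[leRHS]mulr1 -s1 frame_horo_geI.
have bnd t v : `|qform A (x - y t) v| <= (hfun A (y t) x + unorm A (y t)) * ⟪v, v⟫.
  by rewrite hfunE subrK; apply: unorm_bound.
have [s [s1 [[ps <-]|[ps <-]]]] := frame_horo_attained op IJ x.
  apply: (limit_lower aJ hl) => // t v; rewrite aE.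
  by have := bnd t v; rewrite mulrDl ler_norml => /andP[]; lra.
apply: (limit_lower bI hl) => // t v; rewrite bE.
by have := bnd t v; rewrite mulrDl ler_norml => /andP[]; lra.
Qed.

End Limit.

End FrameHoro.

(** * Horofunctions *)

Section Horofunctions.
Context (R : realType) (V : vectType R) (A : euclidean_jordan_algebra V).
Implicit Types (x y z v w c s : V) (l : R).

Local Notation "x • y" := (jmul A x y) (at level 40, left associativity).
Local Notation "⟪ x , y ⟫" := (jip A x y) (format "⟪ x ,  y ⟫").
Local Notation u := (junit A).

Lemma ptws_cvgP (X : Type) (F : set_system X) {FF : Filter F}
    (f : X -> {ptws V -> R}) (g : {ptws V -> R}) :
  {ptws, f t @[t --> F] --> g} <-> forall x, f t x @[t --> F] --> g x.
Proof.
split=> [fg x|fg].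
  have gx : {for g, continuous (fun h : {ptws V -> R} => h x)}.
    exact: (@proj_continuous V (fun=> R) x g).
  exact: (cvg_comp _ _ fg gx).
apply/cvg_sup => x; apply/cvg_image.
  by rewrite eqEsubset; split=> // l _; exists (fun=> l).
move=> B /fg FB; exists ((fun h : V -> R => h x) @^-1` B) => //.
by rewrite image_preimage // eqEsubset; split=> // l _; exists (fun=> l).
Qed.

Lemma ultra_pigeonhole (X : Type) (F : set_system X) (FU : UltraFilter F)
    (T : finType) (f : X -> T) : exists i, F [set t | f t = i].
Proof.
apply: contrapT => /forallNP H; have FP := @ultra_proper _ _ FU.
have H' i : F [set t | f t <> i].
  by have [/H|] := in_ultra_setVsetC [set t | f t = i] FU.
have /filter_ex[t tP] : F [set t | forall i, f t <> i] by exact: filter_forall.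
exact: tP (f t) erefl.
Qed.

Lemma unormZ l x : unorm A (l *: x) <= `|l| * unorm A x.
Proof.
apply: unorm_min => [|s]; first by rewrite mulr_ge0 ?unorm_ge0.
by rewrite qformZ normrM -mulrA ler_wpM2l ?unorm_bound.
Qed.

Lemma unorm0 : unorm A 0 = 0.
Proof.
apply/eqP; rewrite eq_le unorm_ge0 andbT.
by have := unormZ 0 0; rewrite scale0r normr0 mul0r.
Qed.

Lemma unorm_sum (T : Type) (r : seq T) (f : T -> V) :
  unorm A (\sum_(i <- r) f i) <= \sum_(i <- r) unorm A (f i).
Proof.
elim/big_ind2: _ => [|a b c d ab cd|i _ //]; first by rewrite unorm0.
by apply: le_trans (unormD _ _ _) _; apply: lerD.
Qed.

Lemma wcvg_unorm (X : Type) (F : set_system X) {FF : ProperFilter F}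
    (f : X -> V) v : wcvg A F f v -> unorm A (f t - v) @[t --> F] --> (0 : R).
Proof.
move=> fv; pose b := vbasis {:V}.
pose bnd w : R := \sum_i `|coord b i w| * unorm A b`_i.
have le w : unorm A w <= bnd w.
  rewrite {1}[w](coord_vbasis (memvf w)) (le_trans (unorm_sum _ _)) //.
  by apply: ler_sum => i _; apply: unormZ.
have f0 : wcvg A F (fun t => f t - v) 0.
  by rewrite -(subrr v); apply: wcvgB => //; apply: wcvg_cst.
have bnd0 : bnd (f t - v) @[t --> F] --> (0 : R).
  have <- : bnd 0 = 0 by rewrite /bnd big1 // => i _; rewrite linear0 normr0 mul0r.
  apply: cvg_big => [|i _]; first exact: add_continuous.
  apply: cvgM; last exact: cvg_cst.
  by apply: cvg_norm; apply: wcvg_coord f0.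
apply: (squeeze_cvgr _ _ bnd0); last exact: (cvg_cst 0).
by apply: filterE => t; rewrite unorm_ge0 le.
Qed.

Lemma hfun_cvg (X : Type) (F : set_system X) {FF : ProperFilter F}
    (f : X -> V) v x : wcvg A F f v ->
  hfun A (f t) x @[t --> F] --> (hfun A v x : R).
Proof.
move=> fv; apply/cvgrPdist_le => e e0.
have /cvgrPdist_le/(_ (e / 2)) : unorm A (f t - v) @[t --> F] --> (0 : R).
  exact: wcvg_unorm.
rewrite divr_gt0 // => /(_ isT); apply: filterS => t.
rewrite sub0r normrN ger0_norm ?unorm_ge0 // => H; rewrite !hfunE.
have := unormD A (x - f t) (f t - v); have := unormD A (x - v) (v - f t).
have := unormD A (f t - v) v; have := unormD A (v - f t) (f t).
rewrite !addrA !subrK -(unormN A (v - f t)) opprB => *.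
by rewrite ler_norml; apply/andP; split; lra.
Qed.

Lemma jip_unorm x : ⟪x, x⟫ <= unorm A x ^+ 2 * ⟪u, u⟫.
Proof.
have [T [c [mu [oc cu xE _]]]] := spectral (unit_idem A) (jmul1 A x).
have [cc _ _] := oc; have n0 := unorm_ge0 A x.
have cE y nu i : y = \sum_i nu i *: c i -> ⟪c i, y⟫ = nu i * ⟪c i, c i⟫.
  move=> ->; rewrite -{1}(cc i) jip_selfadjoint jmulC orth_idem_comb_mul //.
  by rewrite jipZr.
have -> : ⟪u, u⟫ = \sum_i ⟪c i, c i⟫.
  rewrite -{1}cu jip_suml; apply: eq_bigr => i _.
  rewrite (cE u (fun=> 1)) ?mul1r //.
  by rewrite -cu; apply: eq_bigr => j _; rewrite scale1r.
rewrite {1}xE jip_suml mulr_sumr; apply: ler_sum => i _.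
rewrite jipZl (cE x mu) // mulrA -expr2 ler_wpM2r ?jip_ge0 //.
rewrite -(real_normK (num_real (mu i))) lerXn2r ?nnegrE //.
by rewrite xE unorm_comb_ge.
Qed.

Section FrameSequence.
Context (r : nat) (p : 'I_r -> V) (I J : {set 'I_r}) (alpha : 'I_r -> R).
Context (op : orth_idem A p) (pu : \sum_i p i = u).
Context (IJ : horo_data I J alpha).

(* Starting the ray at parameter [B >= alpha i] makes its norm linear from the
   start. *)
Let B : R := \sum_i `|alpha i|.
Definition ray_coef (n : nat) i : R :=
  if i \in J then alpha i - (n%:R + B)
  else if i \in I then n%:R + B - alpha i else 0.
(** Up to the shift [B], the point [unorm y + mu i = alpha i] on [J] and
    [unorm y - mu i = alpha i] on [I] at distance [n] from the origin. *)
Definition ray n : V := \sum_i ray_coef n i *: p i.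

Let u0 : u != 0.
Proof.
have [_ _ _ [i _ _]] := IJ; have [_ p0 _] := op.
by apply: contraNneq (p0 i) => u0; rewrite -(jmul1 A (p i)) u0 jmul0l.
Qed.

Let disj i : i \in I -> i \in J = false.
Proof.
move=> iI; have [/setP/(_ i)] := IJ; rewrite !inE iI /=.
by move=> ->.
Qed.

Let alpha_bound i : i \in I :|: J -> 0 <= alpha i <= B.
Proof.
have [_ _ a0 _] := IJ => /a0 ai; rewrite ai /B (bigD1 i) //= ger0_norm //.
by rewrite lerDl sumr_ge0.
Qed.

Let alphaJ i : i \in J -> 0 <= alpha i <= B.
Proof. by move=> iJ; apply: alpha_bound; rewrite inE iJ orbT. Qed.

Let alphaI i : i \in I -> 0 <= alpha i <= B.
Proof. by move=> iI; apply: alpha_bound; rewrite inE iI. Qed.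

Let B0 : 0 <= B. Proof. by rewrite sumr_ge0. Qed.

Lemma unorm_ray n : unorm A (ray n) = n%:R + B.
Proof.
have n0 : 0 <= n%:R :> R by [].
apply/eqP; rewrite eq_le; apply/andP; split.
  apply: (unorm_comb_le op pu) => [|i]; first by rewrite addr_ge0.
  rewrite /ray_coef; case: ifPn => [iJ|_].
    have /andP[] := alphaJ iJ.
    by move: n0 B0 => ? ? ? ?; rewrite ler_norml; apply/andP; split; lra.
  case: ifPn => [iI|_]; last by rewrite normr0 addr_ge0.
  have /andP[] := alphaI iI.
  by move: n0 B0 => ? ? ? ?; rewrite ler_norml; apply/andP; split; lra.
have [_ _ _ [i iIJ ai]] := IJ.
apply: le_trans (unorm_comb_ge (ray_coef n) op i).
move: iIJ; rewrite /ray_coef inE ai sub0r subr0 orbC.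
by case: (i \in J) => /= [_|->]; rewrite ?normrN ger0_norm ?addr_ge0.
Qed.

Lemma unorm_ray_sub m n : (m <= n)%N ->
  unorm A (ray n - ray m) <= n%:R - m%:R.
Proof.
move=> mn; have mn' : (m%:R : R) <= n%:R by rewrite ler_nat.
have -> : ray n - ray m = \sum_i (ray_coef n i - ray_coef m i) *: p i.
  by rewrite -sumrB; apply: eq_bigr => i _; rewrite scalerBl.
apply: (unorm_comb_le op pu) => [|i]; first by rewrite subr_ge0.
rewrite /ray_coef ler_norml; case: ifP => _; first by apply/andP; split; lra.
by case: ifP => _; apply/andP; split; lra.
Qed.

Lemma hfun_ray_cvg_ultra (F : set_system nat) (FU : UltraFilter F) x :
  \oo `<=` F -> hfun A (ray n) x @[n --> F] --> frame_horo A p I J alpha x.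
Proof.
move=> ooF; have FP := @ultra_proper _ _ FU.
have large M : F [set n | M <= n%:R + B].
  apply: ooF; exists (Num.truncn `|M|).+1 => // n /= Mn.
  have := truncnS_gt `|M|; have := ler_norm M; have := B0.
  have : ((Num.truncn `|M|).+1%:R : R) <= n%:R by rewrite ler_nat.
  lra.
apply: (frame_horo_limit FU (fun=> op) (fun=> pu) op pu _
  (mu := ray_coef)) => // i.
- by apply: wcvg_cst.
- move=> iJ; under eq_cvg do rewrite unorm_ray /ray_coef iJ addrC subrK.
  exact: cvg_cst.
- move=> iJ M; apply: filterS (large M) => n /=; rewrite unorm_ray.
  rewrite /ray_coef (negPf iJ); case: ifPn => [iI|_]; last by rewrite addr0.
  have /andP[] := alphaI iI.
  by have : 0 <= n%:R :> R by []; lra.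
- move=> iI; under eq_cvg do
    rewrite unorm_ray /ray_coef disj // iI opprB addrC subrK.
  exact: cvg_cst.
- move=> iI M; apply: filterS (large M) => n /=; rewrite unorm_ray.
  rewrite /ray_coef (negPf iI); case: ifPn => [iJ|_]; last by rewrite subr0.
  have /andP[] := alphaJ iJ.
  by have : 0 <= n%:R :> R by []; lra.
Qed.

(** Along the geodesic the functions decrease, so that the limit along one
    ultrafilter is the limit. *)
Lemma hfun_ray_cvg x :
  hfun A (ray n) x @[n --> \oo] --> (frame_horo A p I J alpha x : R).
Proof.
have mono : nonincreasing_seq (fun n => hfun A (ray n) x : R).
  apply/nonincreasing_seqP => n; rewrite !hfunE !unorm_ray.
  have := unormD A (x - ray n) (ray n - ray n.+1); rewrite addrA subrK.
  have := unorm_ray_sub (leqnSn n); rewrite -unormN opprB; lra.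
have /(nonincreasing_is_cvgn mono)/cvg_ex[l hl] :
    has_lbound (range (fun n => hfun A (ray n) x : R)).
  exists (- unorm A x) => _ [n _ <-].
  by have := hfun_bound A (ray n) x; rewrite ler_norml => /andP[].
have [G [GU ooG]] := @ultraFilterLemma nat \oo _.
have GP := @ultra_proper _ _ GU.
suff <- : l = frame_horo A p I J alpha x by [].
have lG : (hfun A (ray n) x : R) @[n --> G] --> l by move=> U /hl; apply: ooG.
have hG : (hfun A (ray n) x : R) @[n --> G] --> frame_horo A p I J alpha x.
  exact: hfun_ray_cvg_ultra.
exact: cvg_unique lG hG.
Qed.

Lemma frame_horo_ray : {ptws, hfun A (ray n) @[n --> \oo] -->
  (frame_horo A p I J alpha : {ptws V -> R})}.
Proof. by apply/ptws_cvgP => x; apply: hfun_ray_cvg. Qed.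

(** In contrast, [hfun y] is bounded below by [- unorm y]. *)
Lemma frame_horo_unbounded (m : R) : 0 <= m ->
  frame_horo A p I J alpha (m *: (frame_sum p I - frame_sum p J)) <= - m.
Proof.
move=> m0; set x := _ *: _.
have q0 (K L : {set 'I_r}) s : frame_sum p K • s = s ->
    (forall i, i \in L -> i \notin K) -> qform A (frame_sum p L) s = 0.
  move=> ps dis; rewrite qform_sum big1 // => i iL.
  by rewrite qformE (frame_sum_fixed0 op ps) ?dis ?jip0l.
have pen (K : {set 'I_r}) z s : {subset K <= I :|: J} ->
    penalized A p K alpha z s <= qform A z s.
  move=> KIJ; rewrite lerBlDr lerDl sumr_ge0 // => i /KIJ/alpha_bound/andP[a0 _].
  by rewrite mulr_ge0 // qform_idem_ge0 //; have [pp _ _] := op.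
have [s [s1 [[ps <-]|[ps <-]]]] := frame_horo_attained op IJ x.
  apply: le_trans (pen _ _ _ _) _; first by move=> i iJ; rewrite inE iJ orbT.
  rewrite qformZ qformB (qform_unit ps) (q0 _ _ _ ps) => [|i iI].
    by rewrite s1; lra.
  by rewrite disj.
apply: le_trans (pen _ _ _ _) _; first by move=> i iI; rewrite inE iI.
rewrite qformN qformZ qformB (qform_unit ps) (q0 _ _ _ ps) => [|i iJ].
  by rewrite s1; lra.
by apply/negP => /disj; rewrite iJ.
Qed.

Lemma frame_horo_horofunction : horofunction A (frame_horo A p I J alpha).
Proof.
split.
  move=> U /frame_horo_ray [N _ NU]; exists (hfun A (ray N)).
  by split; [exists (ray N)|apply: (NU N) => /=].
move=> [y _ hE]; have m0 : 0 <= unorm A y + 1 by rewrite addr_ge0 ?unorm_ge0.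
have := frame_horo_unbounded m0; rewrite -hE hfunE.
set x := _ *: _; have := unorm_ge0 A (x - y); lra.
Qed.

Lemma frame_horo_busemann : busemann_point A (frame_horo A p I J alpha).
Proof.
split; first exact: frame_horo_horofunction.
exists nat, (fun m n => (m <= n)%N), ray; split.
- split; [by constructor; exact: 0%N|by []|by move=> a b c; exact: leq_trans|].
  by move=> a b; exists (maxn a b); rewrite leq_maxl leq_maxr.
- exists 0 => e e0; exists 0%N => n m _ mn; rewrite !subr0 !unorm_ray.
  by have := unorm_ray_sub mn; lra.
- move=> U /frame_horo_ray [N _ NU]; exists N => n Nn.
  exact: NU.
Qed.

End FrameSequence.

End Horofunctions.

Section Classification.
Context (R : realType) (V : vectType R) (A : euclidean_jordan_algebra V).
Context (r : nat) (rank_r : jrank A r).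

Local Notation "x • y" := (jmul A x y) (at level 40, left associativity).
Local Notation "⟪ x , y ⟫" := (jip A x y) (format "⟪ x ,  y ⟫").
Local Notation u := (junit A).

Lemma compactification_ultra (g : {ptws V -> R}) : horo_compactification A g ->
  exists G : set_system V, UltraFilter G /\
    forall x, hfun A y x @[y --> G] --> (g x : R).
Proof.
move=> gcl; pose F := filter_from (nbhs g) (fun B => hfun A @^-1` B).
have FF : ProperFilter F.
  apply: filter_from_proper => [|B /gcl[_ [[y _ <-] By]]]; last by exists y.
  apply: filter_from_filter; first by exists setT; exact: filterT.
  by move=> B C gB gC; exists (B `&` C) => //; exact: filterI.
have [G [GU FG]] := ultraFilterLemma FF; have GP := @ultra_proper _ _ GU.
exists G; split=> //; apply/ptws_cvgP => B gB.
by apply: FG; exists B.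
Qed.

Lemma bounded_limit_in_range (G : set_system V) (GU : UltraFilter G)
    (g : V -> R) (C : R) :
  (forall x, hfun A y x @[y --> G] --> (g x : R)) ->
  G [set y | unorm A y <= C] -> range (hfun A) g.
Proof.
move=> hg GC; have GP := @ultra_proper _ _ GU.
have [y yG] : exists y, wcvg A G id y.
  apply: (ultra_bounded_wcvg GU (C := C ^+ 2 * ⟪u, u⟫)).
  apply: filterS GC => y /= yC; apply: le_trans (jip_unorm _ _) _.
  have y0 := unorm_ge0 A y.
  by rewrite ler_wpM2r ?jip_ge0 // lerXn2r // nnegrE (le_trans y0).
exists y => //; apply/funext => x.
have hy : (hfun A y x : R) @[y --> G] --> hfun A y x by apply: hfun_cvg.
exact: cvg_unique hy (hg x).
Qed.

(** A net that leaves every ball is followed through frames of its points;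
    the coefficients that stay at bounded distance from [- unorm y] or from
    [unorm y] make up [J] and [I]. *)
Lemma horofunction_frame (g : V -> R) : horofunction A g ->
  exists (p : 'I_r -> V) (I J : {set 'I_r}) (alpha : 'I_r -> R),
    [/\ jordan_frame A p, horo_data I J alpha & g = frame_horo A p I J alpha].
Proof.
move=> [/compactification_ultra[G [GU hg]] gran].
have GP := @ultra_proper _ _ GU.
have unbounded C : G [set y | C < unorm A y].
  have [yC|] := in_ultra_setVsetC [set y | unorm A y <= C] GU.
    by case: gran; exact: bounded_limit_in_range hg yC.
  by apply: filterS => y /= /negP; rewrite -ltNge.
have u0 : u != 0.
  apply/eqP => u0; have [y /=] := filter_ex (unbounded 0).
  by rewrite -(jmul1 A y) u0 jmul0l unorm0 ltxx.
have /choice[q] y : exists q : 'I_r -> V, exists mu : 'I_r -> R,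
    [/\ orth_idem A q, \sum_i q i = u & y = \sum_i mu i *: q i].
  exact: frame_decomposition.
move=> /choice[mu /all_and3[oq qu yE]].
have [p [qp op pu]] := orth_idem_limit GU oq qu.
pose a y i := unorm A y + mu y i; pose b y i := unorm A y - mu y i.
have ab0 y i : 0 <= a y i /\ 0 <= b y i.
  have := unorm_comb_ge (mu y) (oq y) i; rewrite -yE /a /b ler_norml.
  by move=> /andP[]; split; lra.
pose J := [set i | `[< exists M, G [set y | a y i <= M]%classic >]]%SET.
pose I := [set i | `[< exists M, G [set y | b y i <= M]%classic >]]%SET.
have JP i : reflect (exists M, G [set y | a y i <= M]) (i \in J).
  by rewrite inE; apply: asboolP.
have IP i : reflect (exists M, G [set y | b y i <= M]) (i \in I).
  by rewrite inE; apply: asboolP.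
have disj i : i \in I -> i \in J -> False.
  move=> /IP[M bM] /JP[N aN].
  have [y /= [[bMy aNy]]] :=
    filter_ex (filterI (filterI bM aN) (unbounded ((M + N) / 2))).
  by move: bMy aNy; rewrite /a /b; lra.
have bounded_cvg (c : V -> R) M : (forall y, 0 <= c y) ->
    G [set y | c y <= M] -> exists l : R, c @ G --> l.
  move=> c0 cM; apply: (ultra_bounded_cvg GU (C := M)).
  by apply: filterS cM => y /=; rewrite ger0_norm.
have infinite (c : V -> R) : ~ (exists M, G [set y | c y <= M]) ->
    forall M, G [set y | M <= c y].
  move=> H M; have [cM|] := in_ultra_setVsetC [set y | c y <= M] GU.
    by case: H; exists M.
  by apply: filterS => y /= /negP; rewrite -ltNge => /ltW.
have /choice[alpha alphaP] i : exists l : R,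
    (i \in J -> a^~ i @ G --> l) /\ (i \in I -> b^~ i @ G --> l).
  have [iJ|iJ] := boolP (i \in J).
    have [M aM] := JP _ iJ.
    have [||l al] := bounded_cvg (a^~ i) M _ _ => // [y|].
      by have [] := ab0 y i.
    by exists l; split=> // iI; case: (disj i).
  have [iI|iI] := boolP (i \in I); last by exists 0.
  have [M bM] := IP _ iI.
  have [||l bl] := bounded_cvg (b^~ i) M _ _ => // [y|].
    by have [] := ab0 y i.
  by exists l; split.
have IJ : horo_data I J alpha.
  have ge0 (c : V -> R) l : (forall y, 0 <= c y) -> c @ G --> (l : R) -> 0 <= l.
    by move=> c0 cl; apply: (cvgr_to_ge cl); apply: filterE.
  have [i [iIJ i0]] : exists i, i \in I :|: J /\ alpha i = 0.
    have /choice[f fP] y : exists ib : 'I_r * bool,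
        (if ib.2 then a y ib.1 else b y ib.1) = 0.
      have [i yi] := unorm_comb_eq (mu y) (oq y) (qu y) u0; rewrite -yE in yi.
      have [mu0|mu0] := leP 0 (mu y i).
        by exists (i, false); rewrite /b /= yi ger0_norm // subrr.
      by exists (i, true); rewrite /a /= yi ltr0_norm // addNr.
    have [[i e] Gi] := ultra_pigeonhole GU f; exists i.
    have zero (c : V -> R) : G [set y | c y = 0] ->
        (exists M, G [set y | c y <= M]) /\
        (forall l : R, c @ G --> l -> l = 0).
      move=> Gc; split; first by exists 0; apply: filterS Gc => y /= ->.
      move=> l cl; have c0 : (fun=> 0 : R) @ G --> (0 : R) by apply: cvg_cst.
      have cc0 : c @ G --> (0 : R).
        apply: cvg_trans c0; apply: near_eq_cvg.
        by apply: filterS Gc => y /= ->.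
      exact: cvg_unique cl cc0.
    have [aP bP] := alphaP i; case: e Gi => Gi.
      have [|bd lim] := zero (a^~ i).
        by apply: filterS Gi => y /= fy; have := fP y; rewrite fy.
      by have iJ := introT (JP i) bd; rewrite inE iJ orbT; split; [|apply/lim/aP].
    have [|bd lim] := zero (b^~ i).
      by apply: filterS Gi => y /= fy; have := fP y; rewrite fy.
    by have iI := introT (IP i) bd; rewrite inE iI; split; [|apply/lim/bP].
  split; last by exists i.
  - apply/setP => j; rewrite !inE -[RHS]/false.
    by apply/negP => /andP[jI jJ]; apply: (disj j); rewrite inE.
  - by apply/set0Pn; exists i.
  - move=> j; have [aP bP] := alphaP j; rewrite inE => /orP[/bP|/aP].
      by apply: ge0 => y; have [] := ab0 y j.
    by apply: ge0 => y; have [] := ab0 y j.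
exists p, I, J, alpha; split=> //.
  exact: orth_idem_frame rank_r u0 _ op pu.
apply/funext => x.
have lim : (hfun A y x : R) @[y --> G] --> frame_horo A p I J alpha x.
  apply: (frame_horo_limit GU oq qu op pu qp yE u0 IJ) => i.
  - exact: (alphaP i).1.
  - by move=> /(elimN (JP i))/(infinite (a^~ i)).
  - exact: (alphaP i).2.
  - by move=> /(elimN (IP i))/(infinite (b^~ i)).
exact: cvg_unique (hg x) lim.
Qed.

End Classification.

Theorem theorem4p2 (R : realType) (V : vectType R)
    (A : euclidean_jordan_algebra V) (r : nat) (rank_r : jrank A r) :
  (forall (p : 'I_r -> V) (I J : {set 'I_r}) (alpha : 'I_r -> R),
     jordan_frame A p -> horo_data I J alpha ->
     horofunction A (frame_horo A p I J alpha)) /\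
  (forall g : V -> R, horofunction A g ->
     (exists (p : 'I_r -> V) (I J : {set 'I_r}) (alpha : 'I_r -> R),
        [/\ jordan_frame A p, horo_data I J alpha &
            g = frame_horo A p I J alpha]) /\
     busemann_point A g).
Proof.
split=> [p I J alpha /jordan_frame_orth_idem[op pu] IJ|g hg].
  exact: frame_horo_horofunction.
have gE := horofunction_frame rank_r hg; split=> //.
have [p [I [J [alpha [/jordan_frame_orth_idem[op pu] IJ ->]]]]] := gE.
exact: frame_horo_busemann.
Qed.
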